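(* Let $n\geq 3$ be a natural number and $R$ a commutative ring. Let $H$ be a subgroup of $O_{2n+1}(R)$. Then $H$ is normalized by $EO_{2n+1}(R)$ if and only if $$EO_{2n+1}(R,I,J)\subseteq H\subseteq CO_{2n+1}(R,I,J)$$ for some admissible pair $(I,J)$.
   Context: Rings are associative with $1\neq 0$. For group elements, $[g,h]:=ghg^{-1}h^{-1}$. Index set: $\Theta:=\{1,\dots,n,0,-n,\dots,-1\}$ and $\Theta_{hb}:=\Theta\setminus\{0\}$. The rows and columns of $(2n+1)\times(2n+1)$ matrices and the coordinates of column vectors $u\in M:=R^{2n+1}$ are indexed by $\Theta$ in the order $1,\dots,n,0,-n,\dots,-1$; $\sigma_{ij}$ denotes the entry of $\sigma$ at position $(i,j)$. Orthogonal group: let $Q:M\to R$, $Q(u)=u_1u_{-1}+\dots+u_nu_{-n}+u_0^2$. Then $O_{2n+1}(R):=\{\sigma\in GL_{2n+1}(R)\mid Q(\sigma u)=Q(u)\ \forall u\in M\}$. Elementary matrices: let $e$ be the identity matrix and $e^{ij}$ ($i,j\in\Theta$) the matrix with $1$ at position $(i,j)$ and $0$ elsewhere. For $i,j\in\Theta_{hb}$ with $i\neq\pm j$ and $x\in R$ set $T_{ij}(x):=e+xe^{ij}-xe^{-j,-i}$ (short root matrix). For $i\in\Theta_{hb}$ and $x\in R$ set $T_i(x):=e+xe^{0,-i}-2xe^{i0}-x^2e^{i,-i}$ (extra short root matrix). These matrices lie in $O_{2n+1}(R)$, and $EO_{2n+1}(R)$ is the subgroup of $O_{2n+1}(R)$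 generated by all of them. An admissible pair is a pair $(I,J)$ of ideals of $R$ such that $2J\subseteq I$, $J^2\subseteq I$ and $I\subseteq J$, where $J^2:=\{x^2\mid x\in J\}$. Let $(I,J)$ be an admissible pair. - $EO_{2n+1}(I,J)$ is the subgroup of $EO_{2n+1}(R)$ generated by all $T_{ij}(x)$ with $i,j\in\Theta_{hb}$, $i\ne\pm j$, $x\in I$, and all $T_i(x)$ with $i\in\Theta_{hb}$, $x\in J$. $EO_{2n+1}(R,I,J)$ is the normal closure of $EO_{2n+1}(I,J)$ in $EO_{2n+1}(R)$. - $O_{2n+1}(R,I,J)$ is the subgroup of all $\sigma\in O_{2n+1}(R)$ such that $\sigma_{ij}\equiv\delta_{ij}\bmod I$ for all $i\in\Theta_{hb}$, $j\in\Theta$, and $\sigma_{0j}\equiv\delta_{0j}\bmod J$ for all $j\in\Theta$. - $CO_{2n+1}(R,I,J):=\{\sigma\in O_{2n+1}(R)\mid[\sigma,EO_{2n+1}(R)]\subseteq O_{2n+1}(R,I,J)\}$. *)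

(* Defs.v *)
From mathcomp Require Export all_boot all_order all_algebra.
From mathcomp Require Export boolp classical_sets.

Set Implicit Arguments.
Unset Strict Implicit.
Unset Printing Implicit Defensive.

Import GRing.Theory.
Local Open Scope classical_set_scope.
Local Open Scope ring_scope.

Section MatrixGroups.
Variables (R : comNzRingType) (m : nat).
Implicit Types (G H X : set 'M[R]_m) (s t : 'M[R]_m).

Definition is_inverse s t : Prop := s *m t = 1%:M /\ t *m s = 1%:M.

Definition GL : set 'M[R]_m := [set s | exists t, is_inverse s t].

(* [invmx] needs decidable units in R; over an arbitrary commutative ring the
   inverse is chosen classically. It is junk (the identity) outside [GL]. *)
Definition minv s : 'M[R]_m := xget 1%:M [set t | is_inverse s t].

Definition mconj t s : 'M[R]_m := t *m s *m minv t.

Definition mcomm s t : 'M[R]_m := s *m t *m minv s *m minv t.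

(* To be used when G is itself a group of invertible matrices. *)
Definition is_subgroup G H : Prop :=
  [/\ H `<=` G, H 1%:M,
      forall s t, H s -> H t -> H (s *m t)
    & forall s, H s -> H (minv s)].

Definition normalized_by G H : Prop :=
  forall g, G g -> [set mconj g h | h in H] = H.

Definition generated G X : set 'M[R]_m := smallest (is_subgroup G) X.

Definition normal_closure G X : set 'M[R]_m :=
  smallest [set N | is_subgroup G N /\ normalized_by G N] X.

End MatrixGroups.

Section Ideals.
Variable R : comNzRingType.
Implicit Types I J : set R.

(* The [idealr] structure of the library only covers proper ideals, whereas
   the unit ideal is allowed here. *)
Definition is_ideal I : Prop :=
  [/\ I 0, forall x y, I x -> I y -> I (x + y)
    & forall a x, I x -> I (a * x)].

Definition admissible I J : Prop :=
  [/\ is_ideal I /\ is_ideal J,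
      forall x, J x -> I (2%:R * x),
      forall x, J x -> I (x ^+ 2)
    & I `<=` J].

End Ideals.

(* The index set {1, ..., n, 0, -n, ..., -1}, in this order, is encoded as
   'I_(n.*2.+1): for 1 <= k <= n, the index k is the ordinal k - 1, the index 0
   is the ordinal n, and -k is the ordinal 2n + 1 - k. Thus i |-> -i is
   [rev_ord]. *)
Notation Theta n := 'I_(n.*2.+1).

Section OddOrthogonal.
Variables (R : comNzRingType) (n : nat).
Implicit Types (i j : Theta n) (I J : set R) (s : 'M[R]_(n.*2.+1)).

Definition th0 : Theta n := inord n.

Definition quadQ (u : 'cV[R]_(n.*2.+1)) : R :=
  (\sum_(i : Theta n | (i < n)%N) u i 0 * u (rev_ord i) 0) + u th0 0 ^+ 2.

Definition Ogrp : set 'M[R]_(n.*2.+1) :=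
  [set s | GL s /\ forall u, quadQ (s *m u) = quadQ u].

Definition Tshort i j (x : R) : 'M[R]_(n.*2.+1) :=
  1%:M + x *: delta_mx i j - x *: delta_mx (rev_ord j) (rev_ord i).

Definition Textra i (x : R) : 'M[R]_(n.*2.+1) :=
  1%:M + x *: delta_mx th0 (rev_ord i) - (2%:R * x) *: delta_mx i th0
  - (x ^+ 2) *: delta_mx i (rev_ord i).

Definition elementary I J : set 'M[R]_(n.*2.+1) :=
  [set s | (exists i j x, [/\ i != th0, j != th0, i != j /\ i != rev_ord j,
                              I x & s = Tshort i j x])
        \/ (exists i x, [/\ i != th0, J x & s = Textra i x])].

Definition EO : set 'M[R]_(n.*2.+1) := generated Ogrp (elementary setT setT).

Definition EOideal I J : set 'M[R]_(n.*2.+1) := generated EO (elementary I J).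

Definition EOrel I J : set 'M[R]_(n.*2.+1) := normal_closure EO (EOideal I J).

Definition Orel I J : set 'M[R]_(n.*2.+1) :=
  [set s | [/\ Ogrp s,
               forall i j, i != th0 -> I (s i j - (i == j)%:R)
             & forall j, J (s th0 j - (th0 == j)%:R)]].

Definition COrel I J : set 'M[R]_(n.*2.+1) :=
  [set s | Ogrp s /\ [set mcomm s t | t in EO] `<=` Orel I J].

End OddOrthogonal.

Arguments Ogrp : clear implicits.
Arguments EO : clear implicits.

(* Main.v *)
Require Import Defs.
From mathcomp Require Import ring zify.

Import GRing.Theory.
Local Open Scope classical_set_scope.
Local Open Scope ring_scope.

Set Implicit Arguments.
Unset Strict Implicit.
Unset Printing Implicit Defensive.

(** Let B be the polarization of Q. For an isotropic vector u and a vector v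
    orthogonal to u, the transvection
      esd u v : w |-> w + B(v,w) u - B(u,w) v - Q(v) B(u,w) u
    is orthogonal, it is additive in v, and an isometry s conjugates it into
    esd (s u) (s v). The elementary root matrices are the transvections
    esd e_i (x e_k) and esd e_i (x e_0), so the whole argument is a calculus of
    transvections.

    Suppose first that EO(R,I,J) <= H <= CO(R,I,J). Then H is normalized by EO
    as soon as [CO(R,I,J), EO] lies in EO(R,I,J) ([COrel_comm]). Since EO is
    perfect ([EO_perfect]) and normal in the orthogonal group ([EO_normal]),
    this reduces to the inclusion of [O(R,I,J), EO] in EO(R,I,J)
    ([Orel_comm]), which is an absolute statement over a larger ring. Let D
    and K be the fibre products of R with itself over R/I and over R/J.
    Admissibility of (I,J) says precisely that D <= K and that Q maps the
    D-module P = D^2n + K to D, and (s,1) maps P to itself when s is in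
    O(R,I,J). So it is enough that every transvection along a unimodular
    isotropic vector u of P is a product of elementary ones
    ([esd_unimodular]). This is proved in the manner of Suslin: modulo u, the
    multiple of v by u_k ^ 2 is a combination of the Koszul vectors
    u_k e_m - B(u,e_m) e_-k, which have two nonzero coordinates; a transvection along u by such a vector, up to a further
    power of u_k, can be written out by means of a hyperbolic plane disjoint
    from the indices involved, and this is where n >= 3 enters. The
    coordinates u_k with k != 0 generate the unit ideal, because the square of
    u_0 lies in the ideal that they generate.

    Conversely, let H be normalized by EO. The parameters of the short and of
    the extra short root matrices in H form an admissible pair (I,J)
    ([level_admissible]). Let s be in H, and let a, b, c be indices which are
    pairwise distinct up to sign. The elements of the exterior square of
    <e_a,e_b,e_c> act by commuting transvections; contracting the volume form
    with the entries of the row a of s gives such an element g for which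
    s g s^-1 fixes e_-a ([esd3_fix]). The commutator of
    s g s^-1 g^-1 with g (esd e_-a y) g^-1 then lies in H and is the product
    of a transvection along e_-a and of a matrix that depends only on the row
    a of s ([esd3_comm]). A further commutator with a transvection along e_-a
    removes the first factor and leaves esd e_-a (- s_ac e_b), so s_ac is in
    I ([entry_apart]). The other entries follow by conjugating s with root
    matrices, and the row of index 0 by another choice of y ([entry_zero]).
    Hence s is congruent to a scalar c modulo (I,J), and
      [s,t] - 1 = ((s - c) t - t (s - c)) s^-1 t^-1
    shows that s lies in CO(R,I,J). *)

(** * The quadratic form and its polarization *)

Section QuadraticSpace.
Context {R : comNzRingType} {n : nat}.
Implicit Types (i j k : Theta n) (u v w : 'cV[R]_(n.*2.+1)) (s : 'M[R]_(n.*2.+1)) (c : R).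

Lemma val_th0 : (th0 n : nat) = n.
Proof. by rewrite /th0 inordK //; lia. Qed.

Lemma hb_val i : (i != th0 n) = ((i : nat) != n).
Proof. by rewrite -val_eqE /= val_th0. Qed.

Lemma rev_th0 : rev_ord (th0 n) = th0 n.
Proof. by apply/val_inj; rewrite /= val_th0; lia. Qed.

Lemma rev_hb {i} : i != th0 n -> rev_ord i != th0 n.
Proof. by rewrite !hb_val /=; have := ltn_ord i; lia. Qed.

Lemma rev_neq {i} : i != th0 n -> rev_ord i != i.
Proof. by rewrite hb_val -val_eqE /=; have := ltn_ord i; lia. Qed.

(** The polarization of [quadQ]; the weight is 2 at the index 0. *)
Definition bpair u w : R :=
  \sum_j (1 + (j == th0 n)%:R) * (u (rev_ord j) 0 * w j 0).

Lemma quadQ_polar u w : quadQ (u + w) = quadQ u + quadQ w + bpair u w.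
Proof.
have bpairE : bpair u w =
    \sum_(j : Theta n | (j < n)%N)
       (u j 0 * w (rev_ord j) 0 + w j 0 * u (rev_ord j) 0)
    + 2%:R * (u (th0 n) 0 * w (th0 n) 0).
  rewrite /bpair (bigID (fun j : Theta n => (j < n)%N)) /=.
  rewrite (bigD1 (th0 n) (P := fun j : Theta n => ~~ (j < n)%N)) /=; last by rewrite val_th0 ltnn.
  rewrite eqxx rev_th0 big_split /= addrCA [RHS]addrC; congr (_ + _).
  rewrite addrC; congr (_ + _).
    rewrite (reindex_inj rev_ord_inj) /=.
    apply: eq_big => [j|j].
      by rewrite hb_val /=; have := ltn_ord j; lia.
    move=> /andP[_ /negbTE ->]; rewrite rev_ordK /=; ring.
  apply: eq_bigr => j ltjn.
  have /negbTE -> : j != th0 n by rewrite hb_val; lia.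
  by rewrite /=; ring.
rewrite bpairE /quadQ big_split /= !mxE.
rewrite (_ : \sum_(i < n.*2.+1 | (i < n)%N) _ = \sum_(i < n.*2.+1 | (i < n)%N) u i 0 * u (rev_ord i) 0
  + \sum_(i < n.*2.+1 | (i < n)%N) w i 0 * w (rev_ord i) 0
  + (\sum_(i < n.*2.+1 | (i < n)%N) u i 0 * w (rev_ord i) 0
  + \sum_(i < n.*2.+1 | (i < n)%N) w i 0 * u (rev_ord i) 0)); first by ring.
by rewrite -!big_split /=; apply: eq_bigr => j _; rewrite !mxE; ring.
Qed.

Lemma quadQZ c u : quadQ (c *: u) = c ^+ 2 * quadQ u.
Proof.
rewrite /quadQ mulrDr mulr_sumr !mxE exprMn; congr (_ + _).
by apply: eq_bigr => i _; rewrite !mxE; ring.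
Qed.

Lemma bpairC u w : bpair u w = bpair w u.
Proof.
have := quadQ_polar u w; rewrite addrC quadQ_polar [_ w + _ u]addrC.
by move/addrI.
Qed.

Lemma bpairDr u v w : bpair u (v + w) = bpair u v + bpair u w.
Proof. by rewrite -big_split; apply: eq_bigr => i _; rewrite !mxE /=; ring. Qed.

Lemma bpairZr c u w : bpair u (c *: w) = c * bpair u w.
Proof. by rewrite mulr_sumr; apply: eq_bigr => i _; rewrite !mxE; ring. Qed.

Lemma bpairDl u v w : bpair (u + v) w = bpair u w + bpair v w.
Proof. by rewrite !(bpairC _ w) bpairDr. Qed.

Lemma bpairZl u c w : bpair (c *: u) w = c * bpair u w.
Proof. by rewrite !(bpairC _ w) bpairZr. Qed.

Lemma bpairNl u w : bpair (- u) w = - bpair u w.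
Proof. by rewrite -scaleN1r bpairZl mulN1r. Qed.

Lemma bpairNr u w : bpair u (- w) = - bpair u w.
Proof. by rewrite !(bpairC u) bpairNl. Qed.

Lemma bpairxx u : bpair u u = 2%:R * quadQ u.
Proof.
have := quadQ_polar u u; rewrite -[u in u + u]scale1r -scalerDl quadQZ => H.
by apply: (@addrI _ (quadQ u + quadQ u)); rewrite -H; ring.
Qed.

Lemma quadQN u : quadQ (- u) = quadQ u.
Proof. by rewrite -scaleN1r quadQZ; ring. Qed.

Lemma bpair_sumr u (I : Type) (r : seq I) (P : pred I) (F : I -> 'cV_(n.*2.+1)) :
  bpair u (\sum_(i <- r | P i) F i) = \sum_(i <- r | P i) bpair u (F i).
Proof.
elim/big_rec2: _ => [|i x y _ <-]; last by rewrite bpairDr.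
by rewrite -[X in bpair u X](scale0r 0) bpairZr mul0r.
Qed.

Definition ev i : 'cV[R]_(n.*2.+1) := delta_mx i 0.

Lemma evE i j : ev i j 0 = (j == i)%:R.
Proof. by rewrite mxE andbT. Qed.

Lemma bpair_ev i w : i != th0 n -> bpair (ev i) w = w (rev_ord i) 0.
Proof.
move=> hi; rewrite /bpair (bigD1 (rev_ord i)) //= big1 => [|j]; last first.
  rewrite evE; case: (rev_ord j =P i) => [<-|_ _]; first by rewrite rev_ordK eqxx.
  by rewrite mul0r mulr0.
by rewrite evE rev_ordK eqxx (negbTE (rev_hb hi)) /=; ring.
Qed.

Lemma bpair_ev0 w : bpair (ev (th0 n)) w = 2%:R * w (th0 n) 0.
Proof.
rewrite /bpair (bigD1 (th0 n)) //= big1 => [|j jn0]; last first.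
  rewrite evE (negbTE (rev_hb jn0)); by rewrite mul0r mulr0.
by rewrite evE rev_th0 eqxx /=; ring.
Qed.

Lemma quadQ_ev i : i != th0 n -> quadQ (ev i) = 0.
Proof.
move=> hi; rewrite /quadQ evE eq_sym (negbTE hi) expr0n addr0 big1 // => j _.
rewrite !evE; case: eqP => [->|_]; last by rewrite mul0r.
by rewrite (negbTE (rev_neq hi)) mulr0.
Qed.

Lemma quadQ_ev0 : quadQ (ev (th0 n)) = 1.
Proof.
rewrite /quadQ evE eqxx expr1n big1 ?add0r // => j ltjn.
by rewrite evE -val_eqE /= val_th0; case: eqP ltjn => [->|]; rewrite ?ltnn ?mul0r.
Qed.

Lemma sum_ev u : u = \sum_i u i 0 *: ev i.
Proof.
apply/colP => i; rewrite summxE (bigD1 i) //= !mxE eqxx mulr1 big1 ?addr0 //.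
by move=> j /negbTE nji; rewrite !mxE eq_sym nji mulr0.
Qed.

Definition isometry s := forall u, quadQ (s *m u) = quadQ u.

Lemma bpair_isometry s u w : isometry s -> bpair (s *m u) (s *m w) = bpair u w.
Proof.
move=> hs; have := hs (u + w); rewrite mulmxDr !quadQ_polar !hs.
by move/addrI.
Qed.

Lemma eq_mx_act s s' : (forall u, s *m u = s' *m u) -> s = s'.
Proof.
move=> h; apply/matrixP => i j; have := h (ev j) => /matrixP /(_ i 0).
by rewrite -!colE !mxE.
Qed.

Lemma mulmx_ev s i j : (s *m ev j) i 0 = s i j.
Proof. by rewrite -colE mxE. Qed.

(** The row vector of the linear form [bpair u]. *)
Definition flat u : 'rV[R]_(n.*2.+1) :=
  \row_j (u (rev_ord j) 0 * (1 + (j == th0 n)%:R)).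

Lemma flatE u w : flat u *m w = (bpair u w)%:M.
Proof.
apply/matrixP => i j; rewrite !mxE !ord1 mulr1n.
by apply: eq_bigr => k _; rewrite !mxE; ring.
Qed.

(** The Eichler-Siegel-Dickson transvection, orthogonal when u is isotropic and
    v is orthogonal to u. *)
Definition esd u v : 'M[R]_(n.*2.+1) :=
  1%:M + u *m flat v - v *m flat u - quadQ v *: (u *m flat u).

Lemma esdE u v w :
  esd u v *m w = w + bpair v w *: u - bpair u w *: v - (quadQ v * bpair u w) *: u.
Proof.
rewrite /esd !(mulmxDl, mulNmx) -scalemxAl -!mulmxA !flatE mul1mx.
by rewrite !mul_mx_scalar scalerA.
Qed.

End QuadraticSpace.

(** * The calculus of transvections *)

Section Transvections.
Context {R : comNzRingType} {n : nat}.
Implicit Types (i j k : Theta n) (u v w f : 'cV[R]_(n.*2.+1)) (s : 'M[R]_(n.*2.+1)) (c : R).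

Definition bpairE := (@bpairDl R n, @bpairDr R n, @bpairZl R n, @bpairZr R n,
  @bpairNl R n, @bpairNr R n, @bpairxx R n, @quadQ_polar R n, @quadQZ R n, @quadQN R n).

Lemma quadQ_esd u v w : quadQ u = 0 -> bpair u v = 0 -> quadQ (esd u v *m w) = quadQ w.
Proof.
move=> qu uv; rewrite esdE !bpairE qu (bpairC v u) ?(bpairC w u) ?(bpairC w v) uv.
by ring.
Qed.

Lemma isometry_esd u v : quadQ u = 0 -> bpair u v = 0 -> isometry (esd u v).
Proof. by move=> qu uv w; rewrite quadQ_esd. Qed.

Lemma esdD u v v' : quadQ u = 0 -> bpair u v = 0 -> bpair u v' = 0 ->
  esd u v *m esd u v' = esd u (v + v').
Proof.
move=> qu uv uv'; apply: eq_mx_act => w; rewrite -mulmxA !esdE !bpairE.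
rewrite qu ?(bpairC v u) ?(bpairC v' u) ?uv ?uv'.
by apply/colP => i; rewrite !mxE; ring.
Qed.

Lemma esd0 u : esd u 0 = 1%:M.
Proof.
have q0 : quadQ (0 : 'cV[R]_(n.*2.+1)) = 0.
  by rewrite -[X in quadQ X](scale0r (0 : 'cV[R]_(n.*2.+1))) quadQZ expr0n mul0r.
have b0 w : bpair (0 : 'cV[R]_(n.*2.+1)) w = 0.
  by rewrite -[X in bpair X](scale0r (0 : 'cV[R]_(n.*2.+1))) bpairZl mul0r.
apply: eq_mx_act => w; rewrite esdE q0 b0 mul1mx.
by apply/colP => i; rewrite !mxE; ring.
Qed.

Lemma esd_conj s u v : isometry s -> s *m esd u v = esd (s *m u) (s *m v) *m s.
Proof.
move=> hs; apply: eq_mx_act => w; rewrite -!mulmxA !esdE !(bpair_isometry _ _ hs) hs.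
by rewrite !(mulmxDr, mulmxN, scalemxAr).
Qed.

(** For isotropic u and v the transvection depends only on the bivector of u
    and v. *)
Lemma esd_swap u v : quadQ u = 0 -> quadQ v = 0 -> esd u v = esd v (- u).
Proof.
move=> qu qv; apply: eq_mx_act => w; rewrite !esdE !bpairE qu qv.
by apply/colP => i; rewrite !mxE; ring.
Qed.

Lemma esdZ c u v : esd (c *: u) v = esd u (c *: v).
Proof.
apply: eq_mx_act => w; rewrite !esdE !bpairE.
by apply/colP => i; rewrite !mxE; ring.
Qed.

Lemma esd_shift c u v : quadQ u = 0 -> bpair u v = 0 -> esd u (v + c *: u) = esd u v.
Proof.
move=> qu uv; apply: eq_mx_act => w; rewrite !esdE !bpairE qu (bpairC v u) uv.
by apply/colP => i; rewrite !mxE; ring.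
Qed.

(** Additivity in the isotropic argument fails only by a transvection in the
    plane of u and u', because v need not be isotropic. *)
Lemma esd_addl u u' v : quadQ u = 0 -> quadQ u' = 0 -> bpair u u' = 0 ->
  bpair u v = 0 -> bpair u' v = 0 ->
  esd (u + u') v = esd u (quadQ v *: u') *m esd u v *m esd u' v.
Proof.
move=> qu qu' uu' uv uv'; apply: eq_mx_act => w; rewrite -!mulmxA !esdE !bpairE.
rewrite qu qu' ?(bpairC v u) ?uv ?(bpairC v u') ?uv' ?(bpairC u' u) ?uu'.
by apply/colP => i; rewrite !mxE; ring.
Qed.

Lemma esdK u v : quadQ u = 0 -> bpair u v = 0 -> esd u v *m esd u (- v) = 1%:M.
Proof. by move=> qu uv; rewrite esdD ?subrr ?esd0 // bpairNr uv oppr0. Qed.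

Lemma esdVK u v : quadQ u = 0 -> bpair u v = 0 -> esd u (- v) *m esd u v = 1%:M.
Proof. by move=> qu uv; rewrite -{2}[v]opprK esdK // bpairNr uv oppr0. Qed.

Lemma esd_conj_fix u f y v : quadQ f = 0 -> bpair f y = 0 -> bpair u f = 0 -> bpair u y = 0 ->
  esd f y *m esd u v *m esd f (- y) = esd u (esd f y *m v).
Proof.
move=> qf fy uf uy; rewrite (esd_conj u v (isometry_esd qf fy)).
rewrite -mulmxA esdK // mulmx1; congr (esd _ _).
by rewrite esdE (bpairC f) uf (bpairC y) uy; apply/colP => i; rewrite !mxE; ring.
Qed.

(** The source of all commutator relations: with B(f,v) = 1 and after a
    multiplication by [esd u (- v)], it expresses a transvection along u by
    the vector y, corrected by a multiple of f. *)
Lemma esd_exchange u f y v : quadQ f = 0 -> bpair f y = 0 -> bpair u f = 0 -> bpair u y = 0 ->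
  bpair v y = 0 ->
  esd f y *m esd u v *m esd f (- y)
    = esd u (v - bpair f v *: y - (quadQ y * bpair f v) *: f).
Proof.
move=> qf fy uf uy vy; rewrite esd_conj_fix //; congr (esd _ _).
by rewrite esdE (bpairC y v) vy; apply/colP => i; rewrite !mxE; ring.
Qed.

End Transvections.

(** * Signed indices *)

Lemma rev_ord_eql n (i k : 'I_n) : (rev_ord i == k) = (i == rev_ord k).
Proof. by rewrite -(inj_eq rev_ord_inj) rev_ordK. Qed.

Ltac ord_hyp := solve [assumption | rewrite eq_sym; assumption].

(** Decides [i != k] from hypotheses of the form [i != k], [i != rev_ord k] and
    [i != th0 n] on the underlying indices. *)
Ltac ord_neq :=
  try apply/negbTE;
  solve [ ord_hyp
        | rewrite (inj_eq rev_ord_inj); ord_hyp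
        | rewrite rev_ord_eql; ord_hyp
        | rewrite -rev_ord_eql; ord_hyp
        | apply: rev_hb; assumption
        | rewrite eq_sym; apply: rev_hb; assumption
        | apply: rev_neq; assumption
        | rewrite eq_sym; apply: rev_neq; assumption ].

(** Evaluates coordinates of explicit combinations of basis vectors. *)
Ltac ev_simp :=
  rewrite ?mxE ?rev_th0 ?rev_ordK ?eqxx ?andbT;
  repeat match goal with |- context [@eq_op ?T ?a ?b] =>
    rewrite (_ : @eq_op T a b = false); [|ord_neq] end;
  rewrite /= ?mulr0n ?mulr1n.

(** The only use of the hypothesis on n: any two indices miss a hyperbolic
    plane. *)
Lemma third_index n (i k : Theta n) : (3 <= n)%N ->
  exists m : Theta n, [/\ m != th0 n, m != i, m != rev_ord i, m != k & m != rev_ord k].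
Proof.
move=> hn.
pose a := minn i (n.*2 - i); pose b := minn k (n.*2 - k).
have [m [mn ma mb]] : exists m, [/\ (m < n)%N, m != a & m != b].
  case: (boolP ((0 != a) && (0 != b)))%N => [/andP[? ?]|h0].
    by exists 0%N; split => //; lia.
  case: (boolP ((1 != a) && (1 != b)))%N => [/andP[? ?]|h1].
    by exists 1%N; split => //; lia.
  by exists 2%N; split; lia.
have mlt : (m < n.*2.+1)%N by lia.
have := ltn_ord i; have := ltn_ord k; rewrite /a /b in ma mb => kn iN.
by exists (Ordinal mlt); split; rewrite -val_eqE /= ?val_th0; lia.
Qed.

Section Generation.
Context {R : comNzRingType} {n : nat}.
Implicit Types (i j k : Theta n) (u v w f : 'cV[R]_(n.*2.+1)) (I J : set R)
  (s : 'M[R]_(n.*2.+1)) (c : R).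

(** As [esd u (- v)] inverts [esd u v], generation by transvections can be
    expressed with monoids. *)
Definition mxmonoid (E : set 'M[R]_(n.*2.+1)) :=
  E 1%:M /\ forall s s', E s -> E s' -> E (s *m s').

(** The column vectors of I^2n + J. For a subring I and a suitable I-module J
    they form a quadratic module over I, see [form_ring]; for ideals I and J
    the columns of s - 1 lie there when s is in O(R,I,J). *)
Definition lattice I J v := (forall i, i != th0 n -> I (v i 0)) /\ J (v (th0 n) 0).

(** The transvections along a fixed e_i form an abelian group, so they are
    products of root matrices. *)
Lemma esd_ev_gen (E : set 'M[R]_(n.*2.+1)) I J i v :
  mxmonoid E -> i != th0 n ->
  (forall k c, k != th0 n -> k != i -> k != rev_ord i -> I c -> E (esd (ev i) (c *: ev k))) ->
  (forall c, J c -> E (esd (ev i) (c *: ev (th0 n)))) ->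
  lattice I J v -> v (rev_ord i) 0 = 0 -> E (esd (ev i) v).
Proof.
move=> [E1 EM] hi EI EJ [vI vJ] vi0; rewrite [v]sum_ev.
suff [] : bpair (ev i) (\sum_k v k 0 *: ev k) = 0 /\ E (esd (ev i) (\sum_k v k 0 *: ev k)) by [].
apply: (big_rec (fun w => bpair (ev i) w = 0 /\ E (esd (ev i) w))) => [|k w _ [iw Ew]].
  by rewrite esd0 bpair_ev // mxE.
have ik0 : bpair (ev i) (v k 0 *: ev k) = 0.
  rewrite bpairZr bpair_ev // evE; case: eqP => [<-|_]; last by rewrite mulr0.
  by rewrite vi0 mul0r.
split; first by rewrite bpairDr iw ik0 addr0.
rewrite -esdD ?quadQ_ev //; apply: EM => //.
have [->|nki] := eqVneq k i.
  by rewrite -[_ *: _]add0r esd_shift ?quadQ_ev ?esd0 // bpair_ev // mxE.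
have [->|nki'] := eqVneq k (rev_ord i).
  by rewrite vi0 scale0r esd0.
have [->|k0] := eqVneq k (th0 n); first exact: EJ.
by apply: EI => //; exact: vI.
Qed.

End Generation.

(** * Transvections along unimodular isotropic vectors *)

Section UnimodularTransvections.
Context {S : comNzRingType} {n : nat} (hn : (3 <= n)%N).
Variables (D K : set S) (E : set 'M[S]_(n.*2.+1)).
Implicit Types (i j k p m : Theta n) (u v w g f : 'cV[S]_(n.*2.+1)) (c t r : S).

(** D is a subring and K a D-module containing D such that Q takes values in D
    on D^2n + K. *)
Record form_ring (D K : set S) : Prop := FormRing {
  fr1 : D 1; frN1 : D (-1);
  frD : forall a b, D a -> D b -> D (a + b);
  frM : forall a b, D a -> D b -> D (a * b);
  frK1 : K 1;
  frKD : forall a b, K a -> K b -> K (a + b);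
  frKM : forall a b, D a -> K b -> K (a * b);
  frQ : forall a, K a -> D (a ^+ 2) }.

Hypothesis DK : form_ring D K.

Let D1 := fr1 DK. Let DN1 := frN1 DK. Let DD := frD DK. Let DM := frM DK.
Let K1 := frK1 DK. Let KD := frKD DK. Let KM := frKM DK. Let DQ := frQ DK.

Lemma frN c : D c -> D (- c).
Proof. by rewrite -mulN1r; apply: DM. Qed.
Lemma fr0 : D 0.
Proof. by rewrite -(subrr 1); apply: DD. Qed.
Lemma frDK c : D c -> K c.
Proof. by move=> Dc; rewrite -[c]mulr1; apply: KM. Qed.
Lemma frKN c : K c -> K (- c).
Proof. by rewrite -mulN1r; apply: KM. Qed.

Notation P := (lattice D K).

Lemma latD u v : P u -> P v -> P (u + v).
Proof.
move=> [uD uK] [vD vK]; split => [i hi|]; rewrite mxE; first by apply: DD; auto.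
by apply: KD.
Qed.
Lemma latZ c u : D c -> P u -> P (c *: u).
Proof.
move=> Dc [uD uK]; split => [i hi|]; rewrite mxE; first by apply: DM; auto.
by apply: KM.
Qed.
Lemma latN u : P u -> P (- u).
Proof. by rewrite -scaleN1r; apply: latZ. Qed.
Lemma lat_ev i : P (ev i).
Proof.
have D01 (b : bool) : D b%:R by case: b; [exact: D1 | exact: fr0].
by split => *; rewrite evE //; apply: frDK.
Qed.
Lemma lat_ev0 c : K c -> P (c *: ev (th0 n)).
Proof.
move=> Kc; split => [i hi|]; rewrite mxE evE; first by rewrite (negbTE hi) mulr0; apply: fr0.
by rewrite eqxx mulr1.
Qed.
Lemma quadQ_lat u : P u -> D (quadQ u).
Proof.
move=> [uD uK]; apply: DD => //; last exact: DQ.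
apply: big_ind => [||i ltin]; [exact: fr0|exact: DD|].
have hi : i != th0 n by rewrite hb_val; lia.
by apply: DM; auto; apply/uD/rev_hb.
Qed.
Hypothesis Emon : mxmonoid E.
Hypothesis E_ev : forall i v, i != th0 n -> P v -> v (rev_ord i) 0 = 0 -> E (esd (ev i) v).

Let EM := Emon.2.

Lemma esd_two_ev_mem i k c c' v : i != th0 n -> k != th0 n -> k != rev_ord i ->
  D c -> D c' -> P v -> v (rev_ord i) 0 = 0 -> v (rev_ord k) 0 = 0 ->
  E (esd (c *: ev i + c' *: ev k) v).
Proof.
move=> hi hk kri Dc Dc' Pv vi vk.
rewrite esd_addl ?quadQZ ?quadQ_ev ?mulr0 // ?bpairE ?bpair_ev ?vi ?vk ?mulr0 //; last first.
  by ev_simp; ring.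
rewrite !esdZ; apply: EM; first apply: EM; apply: E_ev => //; try exact: latZ.
- by do ?[apply: latZ => //]; [exact: quadQ_lat | exact: lat_ev].
- by ev_simp; ring.
- by rewrite mxE vi mulr0.
- by rewrite mxE vk mulr0.
Qed.

(** Both vectors are orthogonal to some hyperbolic plane <e_m, e_-m>, and the
    transvection is a commutator of transvections along e_-m and along the
    first vector by e_m. *)
Lemma esd_plane_mem p k c t r : p != th0 n -> k != th0 n -> p != k -> p != rev_ord k ->
  D c -> D t -> D r ->
  E (esd (t *: ev p + (- r) *: ev (rev_ord k)) (c *: (t *: ev k + r *: ev (rev_ord p)))).
Proof.
move=> hp hk npk npk' Dc Dt Dr.
have [m [hm mp mp' mk mk']] := third_index p k hn.
have hk' := rev_hb hk; have hp' := rev_hb hp; have hm' := rev_hb hm.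
set g := t *: ev p + _; set h := t *: ev k + _.
have qg : quadQ g = 0.
  by rewrite !bpairE !quadQ_ev // bpair_ev //; ev_simp; ring.
have qh : quadQ h = 0.
  by rewrite !bpairE !quadQ_ev // bpair_ev //; ev_simp; ring.
have gh : bpair g h = 0.
  by rewrite !bpairE !bpair_ev //; ev_simp; ring.
have gm : bpair g (ev m) = 0.
  by rewrite !bpairE !bpair_ev //; ev_simp; ring.
have hlat : P h by apply: latD; apply: latZ => //; apply: lat_ev.
have Eg v : P v -> v (rev_ord p) 0 = 0 -> v k 0 = 0 -> E (esd g v).
  by move=> Pv vp vk; apply: esd_two_ev_mem; rewrite ?rev_ordK //; [ord_neq | exact: frN].
have ech : E (esd g (ev m + c *: h)).
  have := @esd_exchange _ _ g (ev (rev_ord m)) (- (c *: h)) (ev m).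
  have -> : bpair (ev (rev_ord m)) (ev m) = 1 :> S by rewrite bpair_ev //; ev_simp.
  rewrite quadQN quadQZ qh mulr0 mul0r scale0r subr0 scale1r opprK => <-; first last.
  - by rewrite !bpairE !bpair_ev //; ev_simp; ring.
  - by rewrite bpairNr bpairZr gh; ring.
  - by rewrite !bpairE !bpair_ev //; ev_simp; ring.
  - by rewrite !bpairE !bpair_ev //; ev_simp; ring.
  - exact: quadQ_ev.
  apply: EM; first apply: EM.
  + apply: E_ev => //; first by apply/latN/latZ.
    by rewrite /h; ev_simp; ring.
  + by apply: Eg; [exact: lat_ev | ev_simp | ev_simp].
  + apply: E_ev => //; first by apply/latZ.
    by rewrite /h; ev_simp; ring.
have -> : c *: h = (ev m + c *: h) + - ev m by rewrite addrAC subrr add0r.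
rewrite -esdD //; last by rewrite bpairNr gm oppr0.
  apply: EM => //; apply: Eg; [exact/latN/lat_ev | ev_simp; ring | ev_simp; ring].
by rewrite bpairDr bpairZr gm gh; ring.
Qed.

(** The Koszul relation between the coordinates k and m of the linear form
    B(u, _), in which u_k is the coefficient of e_-k. *)
Definition koszul u k m := u k 0 *: ev m - bpair u (ev m) *: ev (rev_ord k).

Lemma bpair_koszul u k m : k != th0 n -> bpair u (koszul u k m) = 0.
Proof.
move=> hk; rewrite bpairDr bpairNr !bpairZr (bpairC u (ev (rev_ord k))).
by rewrite bpair_ev ?rev_hb // rev_ordK; ring.
Qed.

Lemma koszul_hb u k m : m != th0 n ->
  koszul u k m = u k 0 *: ev m + (- u (rev_ord m) 0) *: ev (rev_ord k).
Proof. by move=> hm; rewrite /koszul bpairC bpair_ev // scaleNr. Qed.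

Lemma fr_polar a b : K a -> K b -> D (2%:R * (a * b)).
Proof.
move=> Ka Kb; rewrite (_ : 2%:R * _ = (a + b) ^+ 2 - a ^+ 2 - b ^+ 2); last by ring.
by apply: DD; [apply: DD|]; try apply: frN; apply: DQ => //; apply: KD.
Qed.

(** Modulo this vector, u_k u splits into a part in the span of the four
    basis vectors of indices k, -k, p, -p, to which [esd_plane_mem] applies, and a part
    orthogonal to both basis vectors of the Koszul vector, to which [esd_two_ev_mem]
    applies. *)
Lemma esd_koszul_mem u k p c : P u -> quadQ u = 0 -> k != th0 n -> p != th0 n ->
  p != k -> p != rev_ord k -> D c ->
  E (esd u ((c * u k 0) *: koszul u k p)).
Proof.
move=> Pu qu hk hp npk npk' Dc; rewrite koszul_hb //.
have hk' := rev_hb hk; have hp' := rev_hb hp.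
have Dt : D (u k 0) by apply: Pu.1.
have Dr : D (u (rev_ord p) 0) by apply: Pu.1.
have Dup : D (u p 0) by apply: Pu.1.
set t := u k 0 in Dt *; set r := u (rev_ord p) 0 in Dr *.
pose h := t *: ev k + r *: ev (rev_ord p).
have plane := esd_plane_mem (p := p) (k := k) (c := - (c * t)) hp hk npk npk' (frN (DM Dc Dt)) Dt Dr.
set g := t *: ev p + _ in plane *; rewrite -/h in plane.
have qg : quadQ g = 0.
  by rewrite !bpairE !quadQ_ev // bpair_ev //; ev_simp; ring.
have gh : bpair g h = 0.
  by rewrite !bpairE !bpair_ev //; ev_simp; ring.
have gu : bpair g u = 0.
  by rewrite !bpairE !bpair_ev // rev_ordK -/t -/r; ring.
(* b is orthogonal to both basis vectors that occur in g. *)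
pose b := t *: u - u p 0 *: g - t *: h.
have gb : bpair g b = 0.
  by rewrite bpairDr bpairNr bpairDr bpairNr !bpairZr gu gh bpairxx qg; ring.
have Pg : P g by apply: latD; apply: latZ; rewrite //; [exact: lat_ev | exact: frN | exact: lat_ev].
have Ph : P h by apply: latD; apply: latZ; rewrite //; exact: lat_ev.
have Pb : P b by apply: latD; [apply: latD|]; rewrite -?scaleN1r; do ?apply: latZ.
(* The Koszul vector g is isotropic, so the transvection is also one along g by
   a multiple of u, where t u may be replaced by t h + b. *)
rewrite (esd_swap qu); last by rewrite quadQZ qg mulr0.
rewrite esdZ.
have -> : (c * t) *: - u = ((- (c * t)) *: h + (- c) *: b) + (- (c * u p 0)) *: g.
  by apply/colP => i; rewrite !mxE; ring.
rewrite esd_shift //; last by rewrite bpairDr !bpairZr gh gb; ring.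
rewrite -esdD //; [|by rewrite bpairZr gh; ring|by rewrite bpairZr gb; ring].
apply: EM => //; apply: esd_two_ev_mem => //; first by ord_neq.
- exact: frN.
- by apply/latZ; first apply: frN.
- by rewrite /b /g /h; ev_simp; rewrite -/r; ring.
- by rewrite rev_ordK /b /g /h; ev_simp; rewrite -/t; ring.
Qed.

(** The Koszul vector of index 0 is not isotropic. The Koszul vectors f1 and f2
    of two opposite indices p and -p, with B(f2,f1) = u_k ^ 2, replace a
    hyperbolic pair orthogonal to it in [esd_exchange]. *)
Lemma esd_koszul0_mem u k c : P u -> quadQ u = 0 -> k != th0 n -> K c ->
  E (esd u ((c * u k 0 ^+ 3) *: koszul u k (th0 n))).
Proof.
move=> Pu qu hk Kc.
have [p [hp npk npk' _ _]] := third_index k k hn.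
have hk' := rev_hb hk; have hp' := rev_hb hp.
have Dt : D (u k 0) by apply: Pu.1.
have y0E : koszul u k (th0 n) = u k 0 *: ev (th0 n) + (- (2%:R * u (th0 n) 0)) *: ev (rev_ord k).
  by rewrite /koszul bpairC bpair_ev0 scaleNr.
have kosp := koszul_hb u k hp; have kosp' := koszul_hb u k hp'; rewrite rev_ordK in kosp'.
have Py : P ((- c) *: koszul u k (th0 n)).
  rewrite y0E scalerDr; apply: latD; rewrite scalerA.
    by apply: lat_ev0; rewrite mulrC; apply: KM => //; apply: frKN.
  apply: latZ; last exact: lat_ev.
  rewrite (_ : - c * _ = 2%:R * (c * u (th0 n) 0)); last by ring.
  by apply: fr_polar => //; case: Pu.
have uy : bpair u (koszul u k (th0 n)) = 0 by apply: bpair_koszul.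
have uf1 : bpair u (koszul u k p) = 0 by apply: bpair_koszul.
have uf2 : bpair u (koszul u k (rev_ord p)) = 0 by apply: bpair_koszul.
have E1 := esd_koszul_mem (c := -1) Pu qu hk hp npk npk' DN1.
have E1' := esd_koszul_mem (c := 1) Pu qu hk hp npk npk' D1.
have E2 a : D a -> E (esd u ((a * u k 0) *: koszul u k (rev_ord p))).
  by move=> Da; apply: esd_koszul_mem => //; ord_neq.
have Ef2 v : P v -> v p 0 = 0 -> v k 0 = 0 -> E (esd (koszul u k (rev_ord p)) v).
  move=> Pv vp vk; rewrite kosp'; apply: esd_two_ev_mem; rewrite ?rev_ordK //; first by ord_neq.
  by apply: frN; apply: Pu.1.
set f1 := koszul u k p in kosp uf1 E1 E1' *; set f2 := koszul u k (rev_ord p) in kosp' uf2 E2 Ef2 *.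
set y0 := koszul u k (th0 n) in y0E Py uy *.
clearbody f1 f2 y0.
have qf2 : quadQ f2 = 0.
  by rewrite kosp' !bpairE !quadQ_ev // bpair_ev //; ev_simp; ring.
have f2y : bpair f2 y0 = 0.
  by rewrite kosp' y0E !bpairE !bpair_ev // ?quadQ_ev //; ev_simp; ring.
have f1y : bpair f1 y0 = 0.
  by rewrite kosp y0E !bpairE !bpair_ev // ?quadQ_ev //; ev_simp; ring.
have f2f1 : bpair f2 f1 = u k 0 ^+ 2.
  by rewrite kosp kosp' !bpairE !bpair_ev // ?quadQ_ev //; ev_simp; ring.
set t := u k 0 in Dt E1 E1' E2 f2f1 *.
have := @esd_exchange _ _ u f2 ((- c) *: y0) ((1 * t) *: f1).
rewrite !bpairZr qf2 f2y uf2 uy f2f1 bpairZl f1y !mulr0 => /(_ erefl erefl erefl erefl erefl).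
set q := quadQ _ => exch.
have Dq : D q by apply: quadQ_lat.
have Ex : E (esd u ((1 * t) *: f1 - (1 * t * t ^+ 2) *: ((- c) *: y0) - (q * (1 * t * t ^+ 2)) *: f2)).
  rewrite -exch; apply: EM; first apply: EM => //.
    by apply: Ef2 => //; rewrite y0E; ev_simp; ring.
  by apply: Ef2; [exact: latN | rewrite y0E; ev_simp; ring | rewrite y0E; ev_simp; ring].
have -> : (c * t ^+ 3) *: y0 = ((1 * t) *: f1 - (1 * t * t ^+ 2) *: ((- c) *: y0) - (q * (1 * t * t ^+ 2)) *: f2)
   + (-1 * t) *: f1 + (q * t ^+ 2 * t) *: f2.
  clear -f1 f2 y0 q; clearbody q t.
  by apply/colP => i; rewrite !mxE; ring.
rewrite -esdD // ?bpairZr ?uf2 ?mulr0 //; last first.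
  by rewrite !(bpairDr, bpairNr, bpairZr) uy uf1 uf2; ring.
rewrite -esdD // ?bpairZr ?uf1 ?mulr0 //; last first.
  by rewrite !(bpairDr, bpairNr, bpairZr) uy uf1 uf2; ring.
apply: EM; first exact: EM.
by apply: E2; apply: DM => //; apply: DM.
Qed.

(** Two factors u_k turn v into a combination of Koszul vectors modulo u, and
    three more are required by the Koszul vector of index 0. *)
Lemma esd_coord_pow_mem u k v : P u -> quadQ u = 0 -> k != th0 n -> P v -> bpair u v = 0 ->
  E (esd u (u k 0 ^+ 5 *: v)).
Proof.
move=> Pu qu hk Pv uv; have hk' := rev_hb hk; have Dt : D (u k 0) by apply: Pu.1.
pose z := u k 0 *: v - v k 0 *: u.
have uz : bpair u z = 0 by rewrite bpairDr bpairNr !bpairZr uv bpairxx qu; ring.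
have zk : z k 0 = 0 by rewrite !mxE; ring.
have Pz : P z.
  by apply: latD; [exact: latZ | apply/latN/latZ => //; apply: Pv.1].
have -> : esd u (u k 0 ^+ 5 *: v) = esd u (u k 0 ^+ 3 *: (u k 0 *: z)).
  rewrite -(@esd_shift _ _ (- (u k 0 ^+ 4 * v k 0)) u (u k 0 ^+ 5 *: v)) //; last first.
    by rewrite bpairZr uv mulr0.
  by congr (esd u _); apply/colP => i; rewrite !mxE; ring.
have -> : u k 0 *: z = \sum_m z m 0 *: koszul u k m.
  have -> : \sum_m z m 0 *: koszul u k m
      = u k 0 *: (\sum_m z m 0 *: ev m) - bpair u (\sum_m z m 0 *: ev m) *: ev (rev_ord k).
    rewrite bpair_sumr scaler_sumr scaler_suml -sumrB; apply: eq_bigr => m _.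
    by rewrite /koszul bpairZr; apply/colP => i; rewrite !mxE; ring.
  by rewrite -sum_ev uz scale0r subr0.
suff [] : bpair u (\sum_m z m 0 *: koszul u k m) = 0
  /\ E (esd u (u k 0 ^+ 3 *: (\sum_m z m 0 *: koszul u k m))) by [].
apply: (big_rec (fun x => bpair u x = 0 /\ E (esd u (u k 0 ^+ 3 *: x)))) => [|m x _ [ux Ex]].
  rewrite scaler0 esd0; split; last by case: Emon.
  by rewrite -(scale0r u) bpairZr mul0r.
have um := bpair_koszul u m hk.
split; first by rewrite bpairDr bpairZr um ux; ring.
rewrite scalerDr -esdD //; [|by rewrite !bpairZr um; ring|by rewrite bpairZr ux; ring].
apply: EM => //; rewrite scalerA.
have [->|m0] := eqVneq m (th0 n).
  by rewrite mulrC; apply: esd_koszul0_mem => //; case: Pz.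
have [->|nmk] := eqVneq m k; first by rewrite zk mulr0 scale0r esd0; case: Emon.
have [->|nmk'] := eqVneq m (rev_ord k).
  rewrite /koszul (bpairC u) bpair_ev // rev_ordK subrr scaler0 esd0; by case: Emon.
rewrite (_ : _ * _ = (z m 0 * u k 0 ^+ 2) * u k 0); last by ring.
by apply: esd_koszul_mem => //; apply: DM; [apply: Pz.1 | apply: DM].
Qed.

(** The coefficients a such that [esd u (a *: v)] is in E for all v form an
    ideal, which contains the fifth power of each u_k with k != 0. The
    equation Q(u) = 0 puts (2 u_0 w_0)^2 in the ideal generated by the u_k, so
    the equation B(u,w) = 1 forces this ideal to be D. *)
Theorem esd_unimodular u v w : P u -> P v -> P w -> quadQ u = 0 -> bpair u v = 0 ->
  bpair u w = 1 -> E (esd u v).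
Proof.
move=> Pu Pv Pw qu uv uw.
pose A a := forall v, P v -> bpair u v = 0 -> E (esd u (a *: v)).
have A0 : A 0 by move=> x _ _; rewrite scale0r esd0; case: Emon.
have AD a b : A a -> A b -> A (a + b).
  move=> Aa Ab x Px ux; rewrite scalerDl -esdD ?bpairZr ?ux ?mulr0 //.
  by apply: EM; [exact: Aa | exact: Ab].
have AM a b : D a -> A b -> A (a * b).
  move=> Da Ab x Px ux; rewrite mulrC -scalerA; apply: Ab; first exact: latZ.
  by rewrite bpairZr ux mulr0.
have DX a N : D a -> D (a ^+ N).
  by move=> Da; elim: N => [//|N IH]; rewrite exprS; apply: DM.
have Dnat N : D N%:R by elim: N => [|N IH]; [exact: fr0 | rewrite -natr1; apply: DD].
pose rad a := D a /\ exists N, A (a ^+ N).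
have rad0 : rad 0 by split; [exact: fr0 | exists 1%N; rewrite expr1].
have radD a b : rad a -> rad b -> rad (a + b).
  move=> [Da [N AN]] [Db [M AbM]]; split; first exact: DD.
  exists (N + M)%N; rewrite exprDn; apply: big_ind => // i _.
  rewrite -mulr_natl; apply: (AM) => //.
  case: (leqP M i) => [leMi|ltiM].
    by rewrite -(subnK leMi) exprD mulrA; apply: (AM) => //; apply: DM; apply: DX.
  have -> : (N + M - i = (M - i) + N)%N by lia.
  by rewrite exprD mulrC mulrA; apply: (AM) => //; apply: DM; apply: DX.
have radM a b : D a -> rad b -> rad (a * b).
  move=> Da [Db [N AN]]; split; first exact: DM.
  by exists N; rewrite exprMn; apply: (AM) => //; apply: DX.
have radu k : k != th0 n -> rad (u k 0).
  move=> hk; split; first by apply: Pu.1.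
  by exists 5 => x Px ux; apply: esd_coord_pow_mem.
have [_ [N]] : rad 1.
  rewrite -uw [w]sum_ev bpair_sumr; apply: big_ind => // j _.
  rewrite bpairZr bpairC.
  have [->|hj] := eqVneq j (th0 n); last first.
    by rewrite bpair_ev //; apply: (radM); [exact: Pw.1 | apply/radu/rev_hb].
  rewrite bpair_ev0 mulrCA; split; first by apply: fr_polar; [case: Pw | case: Pu].
  suff [_ [N AN]] : rad ((2%:R * (w (th0 n) 0 * u (th0 n) 0)) ^+ 2).
    by exists (2 * N)%N; rewrite exprM.
  rewrite (_ : _ ^+ 2 = - (2%:R * (w (th0 n) 0 * w (th0 n) 0)) * 2%:R * - (u (th0 n) 0 ^+ 2)); last by ring.
  apply: (radM); first by apply: DM => //; apply: frN; apply: fr_polar; case: Pw.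
  (* Q(u) = 0 expresses the square of u_0 by the other coordinates. *)
  move/eqP: qu; rewrite /quadQ addr_eq0 => /eqP <-.
  apply: big_ind => // i ltin; have hi : i != th0 n by rewrite hb_val; lia.
  by apply: (radM); [exact: Pu.1 | apply/radu/rev_hb].
by rewrite expr1n => /(_ v Pv uv); rewrite scale1r.
Qed.

End UnimodularTransvections.

(** * Elementary subgroups *)

Section Groups.
Context {R : comNzRingType} {m : nat}.
Implicit Types (G H N X : set 'M[R]_m) (s t g : 'M[R]_m).

Lemma is_inverse_minv s t : is_inverse s t -> minv s = t.
Proof.
move=> [st ts]; rewrite /minv; case: xgetP => [t' _ [st' ts']|/(_ t)]; last first.
  by case.
by rewrite -[t']mul1mx -ts -mulmxA st' mulmx1.
Qed.

Lemma minv_inverse s : GL s -> is_inverse s (minv s).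
Proof. by move=> [t st]; rewrite (is_inverse_minv st). Qed.

Lemma mulmx_minv s : GL s -> s *m minv s = 1%:M.
Proof. by move=> /minv_inverse[]. Qed.

Lemma minv_mulmx s : GL s -> minv s *m s = 1%:M.
Proof. by move=> /minv_inverse[]. Qed.

Lemma mulmx_minvK s t : GL s -> t *m minv s *m s = t.
Proof. by move=> sG; rewrite -mulmxA minv_mulmx // mulmx1. Qed.

Lemma mulmxK_minv s t : GL s -> t *m s *m minv s = t.
Proof. by move=> sG; rewrite -mulmxA mulmx_minv // mulmx1. Qed.

Lemma GL1 : GL (1%:M : 'M[R]_m).
Proof. by exists 1%:M; split; rewrite mul1mx. Qed.

Lemma GLV s : GL s -> GL (minv s).
Proof. by move=> sG; exists s; have [] := minv_inverse sG. Qed.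

Lemma GLM s t : GL s -> GL t -> GL (s *m t).
Proof.
move=> sG tG; exists (minv t *m minv s).
by split; rewrite !mulmxA ?mulmxK_minv ?mulmx_minvK // ?mulmx_minv ?minv_mulmx.
Qed.

Lemma minv1 : minv 1%:M = 1%:M :> 'M[R]_m.
Proof. by apply: is_inverse_minv; split; rewrite mul1mx. Qed.

Lemma minvK s : GL s -> minv (minv s) = s.
Proof. by move=> sG; apply: is_inverse_minv; have [] := minv_inverse sG. Qed.

Lemma minvM s t : GL s -> GL t -> minv (s *m t) = minv t *m minv s.
Proof.
move=> sG tG; apply: is_inverse_minv.
by split; rewrite !mulmxA ?mulmxK_minv ?mulmx_minvK // ?mulmx_minv ?minv_mulmx.
Qed.

Lemma generated_subgroup G X : is_subgroup G G -> X `<=` G ->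
  is_subgroup G (generated G X).
Proof.
move=> Gg XG; split.
- by apply: smallest_sub.
- by move=> Y [[_ Y1 _ _] _].
- by move=> s t Hs Ht Y [YG XY]; have [_ _ YM _] := YG; apply: YM; [apply: Hs|apply: Ht].
- by move=> s Hs Y [YG XY]; have [_ _ _ YV] := YG; apply: YV; apply: Hs.
Qed.

Lemma normalized_byP G N : is_subgroup (GL (R:=R) (m:=m)) G -> N `<=` (GL (R:=R) (m:=m)) ->
  normalized_by G N <-> forall g h, G g -> N h -> N (g *m h *m minv g).
Proof.
move=> [GGL _ _ GV] NGL; split => [nN g h Gg Nh|nN g Gg].
  by rewrite -(nN g Gg); exists h => //; rewrite /mconj.
apply/seteqP; split => [_ [h Nh <-]|h Nh]; first exact: nN.
have gGL := GGL _ Gg; exists (minv g *m h *m g).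
  by rewrite -[X in _ *m X](minvK gGL); apply/nN/Nh/GV.
by rewrite /mconj !mulmxA mulmx_minv // mul1mx mulmxK_minv.
Qed.

End Groups.

Section ElementaryGroups.
Context {R : comNzRingType} {n : nat}.
Implicit Types (i j k : Theta n) (u v w : 'cV[R]_(n.*2.+1)) (s t : 'M[R]_(n.*2.+1)) (I J : set R).
Local Notation GL := (@GL R n.*2.+1).
Local Notation EO := (EO R n).
Local Notation Ogrp := (Ogrp R n).

Lemma Ogrp_subgroup : is_subgroup GL Ogrp.
Proof.
split; first by move=> s [].
- by split; [exact: GL1 | move=> u; rewrite mul1mx].
- move=> s t [sG qs] [tG qt]; split; first exact: GLM.
  by move=> u; rewrite -mulmxA qs.
- move=> s [sG qs]; split; first exact: GLV.
  by move=> u; rewrite -qs mulmxA mulmx_minv // mul1mx.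
Qed.

Lemma is_subgroup_refl G H : is_subgroup (R:=R) (m:=n.*2.+1) G H -> is_subgroup H H.
Proof. by case=> ? ? ? ?; split. Qed.

Lemma is_subgroup_trans G H N : N `<=` G -> is_subgroup (R:=R) (m:=n.*2.+1) H N -> is_subgroup G N.
Proof. by move=> NG [? ? ? ?]; split. Qed.

Lemma esd_inverse u v : quadQ u = 0 -> bpair u v = 0 -> is_inverse (esd u v) (esd u (- v)).
Proof. by move=> qu uv; split; rewrite ?esdK ?esdVK. Qed.

Lemma esd_GL u v : quadQ u = 0 -> bpair u v = 0 -> GL (esd u v).
Proof. by move=> qu uv; exists (esd u (- v)); exact: esd_inverse. Qed.

Lemma minv_esd u v : quadQ u = 0 -> bpair u v = 0 -> minv (esd u v) = esd u (- v).
Proof. by move=> qu uv; apply/is_inverse_minv/esd_inverse. Qed.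

Lemma esd_Ogrp u v : quadQ u = 0 -> bpair u v = 0 -> Ogrp (esd u v).
Proof. by move=> qu uv; split; [exact: esd_GL | exact: isometry_esd]. Qed.

Lemma flat_ev i : i != th0 n -> flat (ev i) = delta_mx 0 (rev_ord i) :> 'rV[R]_(n.*2.+1).
Proof.
move=> hi; apply/rowP => j; rewrite !mxE andbT /= rev_ord_eql.
case: eqP => [->|_]; last by rewrite mul0r.
by rewrite (negbTE (rev_hb hi)) /=; ring.
Qed.

Lemma flatZ c u : flat (c *: u) = c *: flat u.
Proof. by apply/rowP => j; rewrite !mxE mulrA. Qed.

Lemma flat_ev0 : flat (ev (th0 n)) = 2%:R *: delta_mx 0 (th0 n) :> 'rV[R]_(n.*2.+1).
Proof.
apply/rowP => j; rewrite !mxE andbT /= rev_ord_eql rev_th0.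
by case: eqP => _ /=; ring.
Qed.

Lemma Tshort_esd i j x : i != th0 n -> j != th0 n -> Tshort i j x = esd (ev i) (x *: ev (rev_ord j)) :> 'M[R]_(n.*2.+1).
Proof.
move=> hi hj; have hj' := rev_hb hj.
rewrite /esd quadQZ quadQ_ev // mulr0 scale0r subr0 flatZ !flat_ev // rev_ordK.
by rewrite -scalemxAl -scalemxAr !mul_delta_mx.
Qed.

Lemma Textra_esd i x : i != th0 n -> Textra i x = esd (ev i) ((- x) *: ev (th0 n)) :> 'M[R]_(n.*2.+1).
Proof.
move=> hi; rewrite /esd quadQZ quadQ_ev0 flatZ flat_ev0 !flat_ev //.
rewrite -scalemxAl -!scalemxAr !mul_delta_mx.
by apply/matrixP => a b; rewrite !mxE; ring.
Qed.

Lemma elementary_esd I J s : is_ideal I -> is_ideal J -> elementary I J s ->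
  exists i v, [/\ i != th0 n, lattice I J v, v (rev_ord i) 0 = 0 & s = esd (ev i) v].
Proof.
move=> [I0 ID IM] [J0 JD JM] [[i [j [x [hi hj [nij nij'] Ix ->]]]]|[i [x [hi Jx ->]]]].
  exists i, (x *: ev (rev_ord j)); split => //; last exact: Tshort_esd.
    split => [k hk|]; rewrite mxE evE; last first.
      by rewrite eq_sym (negbTE (rev_hb hj)) mulr0.
    by rewrite mulrC; apply: IM.
  by ev_simp; ring.
exists i, ((- x) *: ev (th0 n)); split => //; last exact: Textra_esd.
  split => [k hk|]; rewrite mxE evE; first by rewrite (negbTE hk) mulr0.
  by rewrite eqxx mulr1 -mulN1r; apply: JM.
by rewrite mxE evE (negbTE (rev_hb hi)) mulr0.
Qed.

Lemma esd_elementary (E : set 'M[R]_(n.*2.+1)) I J i v : mxmonoid E -> is_ideal I -> is_ideal J ->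
  elementary I J `<=` E ->
  i != th0 n -> lattice I J v -> v (rev_ord i) 0 = 0 -> E (esd (ev i) v).
Proof.
move=> Emon [I0 ID IM] [J0 JD JM] XE hi vIJ vi.
apply: (esd_ev_gen Emon hi) vIJ vi => [k c hk nki nki' Ic|c Jc]; apply: XE.
  left; exists i, (rev_ord k), c; split => //; [exact: rev_hb| |].
    by rewrite rev_ordK; split; ord_neq.
  by rewrite Tshort_esd ?rev_ordK ?rev_hb.
right; exists i, (- c); split => //; first by rewrite -mulN1r; apply: JM.
by rewrite Textra_esd // opprK.
Qed.

Lemma ideal_setT : is_ideal (setT : set R). Proof. by []. Qed.

Lemma bpair_evr i v : i != th0 n -> v (rev_ord i) 0 = 0 -> bpair (ev i) v = 0.
Proof. by move=> hi; rewrite bpair_ev. Qed.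

Lemma EO_subgroup : is_subgroup Ogrp EO.
Proof.
apply: generated_subgroup; first exact: is_subgroup_refl Ogrp_subgroup.
move=> s /(elementary_esd ideal_setT ideal_setT)[i [v [hi _ vi ->]]].
by apply: esd_Ogrp; [exact: quadQ_ev | exact: bpair_evr].
Qed.

Lemma EO1 : EO 1%:M. Proof. by case: EO_subgroup. Qed.
Lemma EOM s t : EO s -> EO t -> EO (s *m t). Proof. by case: EO_subgroup => _ _ + _; apply. Qed.
Lemma EOV s : EO s -> EO (minv s). Proof. by case: EO_subgroup => _ _ _; apply. Qed.
Lemma EO_O s : EO s -> Ogrp s. Proof. by case: EO_subgroup => + _ _ _; apply. Qed.
Lemma EO_GL s : EO s -> GL s. Proof. by move/EO_O => []. Qed.

Lemma esd_EO i v : i != th0 n -> v (rev_ord i) 0 = 0 -> EO (esd (ev i) v).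
Proof.
move=> hi vi; apply: (esd_elementary _ ideal_setT ideal_setT) => //.
  by split; [exact: EO1 | exact: EOM].
exact: sub_smallest.
Qed.

(** The inverse of a transvection along e_i is again one, so EO is generated as
    a monoid. *)
Lemma EO_ind (P : 'M[R]_(n.*2.+1) -> Prop) :
  P 1%:M -> (forall s t, EO s -> EO t -> P s -> P t -> P (s *m t)) ->
  (forall i v, i != th0 n -> v (rev_ord i) 0 = 0 -> P (esd (ev i) v)) ->
  forall s, EO s -> P s.
Proof.
move=> P1 PM Pesd s.
suff : EO `<=` [set s | [/\ EO s, P s & P (minv s)]] by move=> h /h[].
apply: smallest_sub.
  split.
  - by move=> x [/EO_O].
  - by split; rewrite ?minv1 //; exact: EO1.
  - move=> x y [Ex Px PVx] [Ey Py PVy]; split; [exact: EOM | exact: PM |].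
    rewrite minvM; try exact: EO_GL.
    by apply: PM => //; apply: EOV.
  - by move=> x [Ex Px PVx]; split; rewrite ?minvK //; [exact: EOV | exact: EO_GL].
move=> x /(elementary_esd ideal_setT ideal_setT)[i [v [hi _ vi ->]]].
have uv := bpair_evr hi vi.
split; [exact: esd_EO | exact: Pesd |].
by rewrite minv_esd ?quadQ_ev //; apply: Pesd; rewrite // mxE vi oppr0.
Qed.

Lemma EO_subgroupGL : is_subgroup GL EO.
Proof. by apply: is_subgroup_trans EO_subgroup => s /EO_GL. Qed.

Lemma EO_normal_inP N : N `<=` EO ->
  normalized_by EO N <-> forall g h, EO g -> N h -> N (g *m h *m minv g).
Proof. by move=> NE; apply: normalized_byP EO_subgroupGL _ => h /NE/EO_GL. Qed.

Section Relative.
Variables (I J : set R).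
Hypotheses (II : is_ideal I) (JJ : is_ideal J).

Lemma EOideal_EO : EOideal I J `<=` EO.
Proof.
apply: smallest_sub; first exact: is_subgroup_refl EO_subgroup.
move=> s /(elementary_esd II JJ)[i [v [hi _ vi ->]]]; exact: esd_EO.
Qed.

Lemma EOrel_EO : EOrel I J `<=` EO.
Proof.
apply: smallest_sub; last exact: EOideal_EO.
split; first exact: is_subgroup_refl EO_subgroup.
apply/EO_normal_inP => // g h Eg Eh; apply: EOM; [exact: EOM | exact: EOV].
Qed.

Lemma EOrel_min N : is_subgroup EO N -> (forall g h, EO g -> N h -> N (g *m h *m minv g)) ->
  elementary I J `<=` N -> EOrel I J `<=` N.
Proof.
move=> NE nN XN; apply: smallest_sub; last exact: smallest_sub.
by split => //; apply/EO_normal_inP => //; case: NE.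
Qed.

Lemma EOrel_subgroup : is_subgroup EO (EOrel I J).
Proof.
split; first exact: EOrel_EO.
- by move=> Y [[[_ Y1 _ _] _] _].
- by move=> s t Hs Ht Y [[YG YN] XY]; have [_ _ YM _] := YG; apply: YM; [apply: Hs|apply: Ht].
- by move=> s Hs Y [[YG YN] XY]; have [_ _ _ YV] := YG; apply: YV; apply: Hs.
Qed.

Lemma EOrel1 : EOrel I J (1%:M : 'M[R]_(n.*2.+1)). Proof. by case: EOrel_subgroup. Qed.
Lemma EOrelM s t : EOrel I J s -> EOrel I J t -> EOrel I J (s *m t).
Proof. by case: EOrel_subgroup => _ _ + _; apply. Qed.
Lemma EOrelV s : EOrel I J s -> EOrel I J (minv s).
Proof. by case: EOrel_subgroup => _ _ _; apply. Qed.

Lemma EOrelJ g h : EO g -> EOrel I J h -> EOrel I J (g *m h *m minv g).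
Proof.
move=> Eg Eh Y YY; have [[YG YN] XY] := YY.
have YE : Y `<=` EO by case: YG.
by apply: (proj1 (EO_normal_inP YE) YN) => //; apply: Eh.
Qed.

Lemma esd_EOrel i v : i != th0 n -> lattice I J v -> v (rev_ord i) 0 = 0 ->
  EOrel I J (esd (ev i) v).
Proof.
move=> hi vIJ vi; apply: (esd_elementary _ II JJ) => //.
  by split; [exact: EOrel1 | exact: EOrelM].
apply: (@subset_trans _ (EOideal I J)); exact: sub_smallest.
Qed.

End Relative.

End ElementaryGroups.

(** * The standard commutator formula *)

Section BaseChange.
Context {A B : comNzRingType} {n : nat} (f : {rmorphism A -> B}).
Implicit Types (u v : 'cV[A]_(n.*2.+1)).

Lemma quadQ_map u : quadQ (map_mx f u) = f (quadQ u).
Proof.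
rewrite /quadQ rmorphD rmorph_sum rmorphXn mxE; congr (_ + _).
by apply: eq_bigr => i _; rewrite !mxE rmorphM.
Qed.

Lemma map_ev (i : Theta n) : map_mx f (ev i) = ev i.
Proof. exact: map_delta_mx. Qed.

Lemma map_flat u : map_mx f (flat u) = flat (map_mx f u).
Proof. by apply/rowP => j; rewrite !mxE rmorphM rmorphD rmorph1 rmorph_nat. Qed.

Lemma map_esd u v : map_mx f (esd u v) = esd (map_mx f u) (map_mx f v).
Proof.
rewrite /esd quadQ_map -!map_flat.
by rewrite !(map_mxB, map_mxD, map_mxZ, map_mxM, map_mx1).
Qed.

End BaseChange.

Section PairMatrices.
Context {A B : comNzRingType}.

Definition pairmx {p q} (s : 'M[A]_(p, q)) (t : 'M[B]_(p, q)) : 'M[A * B]_(p, q) :=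
  \matrix_(i, j) (s i j, t i j).

Lemma map_fst_pairmx p q (s : 'M[A]_(p, q)) (t : 'M[B]_(p, q)) : map_mx fst (pairmx s t) = s.
Proof. by apply/matrixP => i j; rewrite !mxE. Qed.

Lemma map_snd_pairmx p q (s : 'M[A]_(p, q)) (t : 'M[B]_(p, q)) : map_mx snd (pairmx s t) = t.
Proof. by apply/matrixP => i j; rewrite !mxE. Qed.

Lemma pairmxE p q (x : 'M[(A * B)%type]_(p, q)) : x = pairmx (map_mx fst x) (map_mx snd x).
Proof. by apply/matrixP => i j; rewrite !mxE; case: (x i j). Qed.

Lemma pairmxM p q r (s : 'M[A]_(p, q)) (t : 'M[B]_(p, q)) (s' : 'M[A]_(q, r)) t' :
  pairmx s t *m pairmx s' t' = pairmx (s *m s') (t *m t').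
Proof.
rewrite [LHS]pairmxE; congr pairmx.
  by rewrite (map_mxM fst) !map_fst_pairmx.
by rewrite (map_mxM snd) !map_snd_pairmx.
Qed.

Lemma pairmx_isometry n (s : 'M[A]_(n.*2.+1)) (t : 'M[B]_(n.*2.+1)) :
  isometry s -> isometry t -> isometry (pairmx s t).
Proof.
move=> hs ht u; rewrite [u]pairmxE pairmxM.
apply: injective_projections.
  by rewrite -!(quadQ_map fst) !map_fst_pairmx hs.
by rewrite -!(quadQ_map snd) !map_snd_pairmx ht.
Qed.

End PairMatrices.

Section Standard.
Context {R : comNzRingType} {n : nat} (hn : (3 <= n)%N).
Variables (I J : set R).
Hypothesis IJ : admissible I J.
Implicit Types (i j k : Theta n) (u v w : 'cV[R]_(n.*2.+1)) (s t : 'M[R]_(n.*2.+1)).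
Local Notation GL := (@GL R n.*2.+1).
Local Notation EO := (EO R n).
Local Notation Ogrp := (Ogrp R n).
Local Notation E := (@EOrel R n I J).

Let II : is_ideal I. Proof. by case: IJ => -[]. Qed.
Let JJ : is_ideal J. Proof. by case: IJ => -[]. Qed.
Let I0 : I 0. Proof. by case: II. Qed.
Let J0 : J 0. Proof. by case: JJ. Qed.
Let ID a b : I a -> I b -> I (a + b). Proof. by case: II => _ + _; apply. Qed.
Let JD a b : J a -> J b -> J (a + b). Proof. by case: JJ => _ + _; apply. Qed.
Let IM a b : I b -> I (a * b). Proof. by case: II => _ _; apply. Qed.
Let JM a b : J b -> J (a * b). Proof. by case: JJ => _ _; apply. Qed.

(* The fibre products of R with itself over R/I and over R/J. *)
Let D2 : set (R * R)%type := [set a | I (a.1 - a.2)].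
Let K2 : set (R * R)%type := [set a | J (a.1 - a.2)].

Lemma double_form_ring : form_ring D2 K2.
Proof.
have [_ J2 JQ IleJ] := IJ.
split; rewrite /D2 /K2 /=.
- by rewrite subrr.
- by rewrite subrr.
- move=> [a a'] [b b'] /= ha hb; rewrite (_ : _ - _ = (a - a') + (b - b')); last by ring.
  exact: ID.
- move=> [a a'] [b b'] /= ha hb; rewrite (_ : _ - _ = b * (a - a') + a' * (b - b')); last by ring.
  by apply: ID; apply: IM.
- by rewrite subrr.
- move=> [a a'] [b b'] /= ha hb; rewrite (_ : _ - _ = (a - a') + (b - b')); last by ring.
  exact: JD.
- move=> [a a'] [b b'] /= ha hb; rewrite (_ : _ - _ = b * (a - a') + a' * (b - b')); last by ring.
  by apply: JD; apply: JM => //; apply: IleJ.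
- move=> [a a'] /= ha.
  rewrite (_ : _ - _ = (a - a') ^+ 2 + a' * (2%:R * (a - a'))); last by ring.
  by apply: ID; [exact: JQ | apply/IM/J2].
Qed.

(* The pairs of congruent elements modulo EO(R,I,J) with second component in
   EO. *)
Let E2 : set 'M[(R * R)%type]_(n.*2.+1) :=
  [set x | EO (map_mx snd x) /\ E (map_mx fst x *m minv (map_mx snd x))].

Lemma double_monoid : mxmonoid E2.
Proof.
split.
  rewrite /E2 /= !map_mx1 minv1 mul1mx.
  by split; [exact: EO1 | exact: EOrel1].
move=> x y [Ex Rx] [Ey Ry]; rewrite /E2 /= !(map_mxM fst, map_mxM snd).
split; first exact: EOM.
have Gx := EO_GL Ex; have Gy := EO_GL Ey.
rewrite minvM //.
have := EOrelM II JJ Rx (EOrelJ Ex Ry).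
by rewrite !mulmxA mulmx_minvK // => h; rewrite !mulmxA.
Qed.

Lemma double_ev i (v : 'cV[(R * R)%type]_(n.*2.+1)) : i != th0 n -> lattice D2 K2 v -> v (rev_ord i) 0 = 0 -> E2 (esd (ev i) v).
Proof.
move=> hi [vD vK] vi.
have v1 : (map_mx fst v) (rev_ord i) 0 = 0 by rewrite mxE vi.
have v2 : (map_mx snd v) (rev_ord i) 0 = 0 by rewrite mxE vi.
have u1 := bpair_evr hi v1; have u2 := bpair_evr hi v2.
have qi := @quadQ_ev R n i hi.
rewrite /E2 /= !(map_esd fst, map_esd snd) !(map_ev fst, map_ev snd).
split; first exact: esd_EO.
rewrite minv_esd // esdD // ?bpairNr ?u2 ?oppr0 //.
apply: esd_EOrel => //; last by rewrite mxE v1 mxE v2 subr0.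
split => [k hk|]; rewrite !mxE; first exact: vD.
exact: vK.
Qed.

(** Conjugating the diagonal transvection (esd e_i v, esd e_i v) by (s,1) gives
    a transvection along (s,1) e_i, a unimodular isotropic vector of the
    lattice over the fibre product, so it lies in [E2]. *)
Lemma Orel_comm_esd s i v : Orel I J s -> i != th0 n -> v (rev_ord i) 0 = 0 ->
  E (mcomm s (esd (ev i) v)).
Proof.
move=> [[sG sQ] sI sJ] hi vi.
pose x : 'M[(R * R)%type]_(n.*2.+1) := pairmx s 1%:M.
have xiso : isometry x by apply: pairmx_isometry => // u; rewrite mul1mx.
have xlat u : lattice D2 K2 (x *m pairmx u u).
  rewrite pairmxM mul1mx.
  have key k : (s *m u) k 0 - u k 0 = \sum_j u j 0 * (s k j - (k == j)%:R).
    rewrite [in X in _ - X](sum_ev u) summxE mxE -sumrB; apply: eq_bigr => j _.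
    by rewrite mxE evE; ring.
  split => [k hk|]; rewrite mxE /D2 /K2 /= key; apply: big_ind => // j _; first exact/IM/sI.
  exact/JM/sJ.
have evp k : ev k = pairmx (ev k) (ev k) :> 'cV[(R * R)%type]_(n.*2.+1).
  by rewrite [LHS]pairmxE !(map_ev fst, map_ev snd).
have := @esd_unimodular _ _ hn _ _ _ double_form_ring double_monoid double_ev
  (x *m ev i) (x *m pairmx v v) (x *m ev (rev_ord i)).
have qi := @quadQ_ev R n i hi; have uv := bpair_evr hi vi.
rewrite xiso !bpair_isometry // quadQ_ev // !bpair_ev // evE eqxx mxE vi.
rewrite {1 2}evp => /(_ (xlat _) (xlat _)); rewrite {1}evp => /(_ (xlat _) erefl erefl erefl)[].
rewrite !(map_esd fst, map_esd snd, map_mxM fst, map_mxM snd).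
rewrite !(map_fst_pairmx, map_snd_pairmx, map_ev fst, map_ev snd) !mul1mx => _.
by rewrite /mcomm (esd_conj _ _ sQ) mulmxK_minv.
Qed.

Lemma mcommMr s t t' : GL s -> GL t -> GL t' ->
  mcomm s (t *m t') = mcomm s t *m (t *m mcomm s t' *m minv t).
Proof.
move=> sG tG tG'; rewrite /mcomm minvM // !mulmxA.
by rewrite (mulmx_minvK _ tG) (mulmx_minvK _ sG).
Qed.

Lemma comm_EOrel_ind s : GL s ->
  (forall i v, i != th0 n -> v (rev_ord i) 0 = 0 -> E (mcomm s (esd (ev i) v))) ->
  forall t, EO t -> E (mcomm s t).
Proof.
move=> sG hs; apply: EO_ind => //.
  by rewrite /mcomm mulmx1 mulmx_minv // minv1 mulmx1; exact: EOrel1.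
move=> t t' Et Et' Rt Rt'; rewrite mcommMr //; try exact: EO_GL.
by apply: EOrelM => //; apply: EOrelJ.
Qed.

Theorem Orel_comm s t : Orel I J s -> EO t -> E (mcomm s t).
Proof.
move=> sR; apply: comm_EOrel_ind; first by case: sR => -[].
by move=> i v hi vi; apply: Orel_comm_esd.
Qed.

End Standard.

(** * Commutators with CO(R,I,J) *)

Section Perfect.
Context {R : comNzRingType} {n : nat} (hn : (3 <= n)%N).
Implicit Types (i j k : Theta n) (u v w : 'cV[R]_(n.*2.+1)) (s t : 'M[R]_(n.*2.+1)).
Local Notation GL := (@GL R n.*2.+1).
Local Notation EO := (EO R n).
Local Notation Ogrp := (Ogrp R n).

Lemma mcomm_EO a b : EO a -> EO b -> EO (mcomm a b).
Proof. by move=> Ea Eb; do ?apply: EOM => //; apply: EOV. Qed.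

Lemma mcommK s t : GL t -> mcomm s t *m t = s *m t *m minv s.
Proof. by move=> tG; rewrite /mcomm mulmx_minvK. Qed.

(** A monoid that contains all commutators of EO contains the generators of EO.
    In [esd_exchange] take f = e_-m and the second vector e_m, for an index m
    different from i and k up to sign. *)
Lemma EO_perfect (E : set 'M[R]_(n.*2.+1)) : mxmonoid E ->
  (forall a b, EO a -> EO b -> E (mcomm a b)) ->
  forall i v, i != th0 n -> v (rev_ord i) 0 = 0 -> E (esd (ev i) v).
Proof.
move=> Emon Ecomm i v hi vi.
have EM := Emon.2.
have key k c m : k != rev_ord i -> m != th0 n -> m != i -> m != rev_ord i -> m != k -> m != rev_ord k ->
  E (esd (ev i) (c *: ev k - quadQ (c *: ev k) *: ev (rev_ord m))).
  move=> nki hm nmi nmi' nmk nmk'; have hm' := rev_hb hm; have hi' := rev_hb hi.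
  have qi := @quadQ_ev R n i hi; have qm := @quadQ_ev R n _ hm'.
  have b1 : bpair (ev (rev_ord m)) (- (c *: ev k)) = 0 by rewrite bpair_ev //; ev_simp; ring.
  have b2 : bpair (ev i) (ev (rev_ord m)) = 0 :> R by rewrite bpair_ev //; ev_simp.
  have bk : bpair (ev i) (ev k) = 0 :> R by rewrite bpair_ev //; ev_simp.
  have b3 : bpair (ev i) (- (c *: ev k)) = 0 by rewrite bpairNr bpairZr bk; ring.
  have b4 : bpair (ev m) (- (c *: ev k)) = 0 by rewrite bpair_ev //; ev_simp; ring.
  have b5 : bpair (ev i) (ev m) = 0 :> R by rewrite bpair_ev //; ev_simp.
  have b6 : bpair (ev (rev_ord m)) (ev m) = 1 :> R by rewrite bpair_ev //; ev_simp.
  have := Ecomm (esd (ev (rev_ord m)) (- (c *: ev k))) (esd (ev i) (ev m)).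
  rewrite /mcomm !minv_esd // esd_exchange // b6 mulr1 quadQN scale1r opprK esdD //.
  - rewrite (_ : _ + - ev m = c *: ev k - quadQ (c *: ev k) *: ev (rev_ord m)).
      apply; apply: esd_EO => //; ev_simp; ring.
    by apply/colP => a; rewrite !mxE; ring.
  - by rewrite !(bpairDr, bpairNr, bpairZr) b5 b2 bk; ring.
  - by rewrite bpairNr b5 oppr0.
have hbk k c : k != th0 n -> k != rev_ord i -> E (esd (ev i) (c *: ev k)).
  move=> hk nki.
  have [m [hm nmi nmi' nmk nmk']] := third_index i k hn.
  by have := key k c m nki hm nmi nmi' nmk nmk'; rewrite quadQZ quadQ_ev // mulr0 scale0r subr0.
apply: (@esd_ev_gen _ _ E setT setT) => //; first by move=> k c hk nki nki' _; apply: hbk.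
move=> c _; have [m [hm nmi nmi' _ _]] := third_index i i hn.
have hm' := rev_hb hm; have hi' := rev_hb hi.
have n1 : th0 n != rev_ord i by ord_neq.
have n2 : m != rev_ord (th0 n) by rewrite rev_th0.
have K := key (th0 n) c m n1 hm nmi nmi' hm n2.
set q := quadQ _ in K.
have -> : c *: ev (th0 n) = (c *: ev (th0 n) - q *: ev (rev_ord m)) + q *: ev (rev_ord m).
  by rewrite subrK.
have b1 : bpair (ev i) (ev (th0 n)) = 0 :> R by rewrite bpair_ev //; ev_simp.
have b2 : bpair (ev i) (ev (rev_ord m)) = 0 :> R by rewrite bpair_ev //; ev_simp.
rewrite -esdD ?quadQ_ev //; last 2 first.
- by rewrite bpairDr bpairNr !bpairZr b1 b2; ring.
- by rewrite bpairZr b2; ring.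
apply: EM => //; apply: hbk => //; ord_neq.
Qed.

(** The case I = J = R of [Orel_comm]. *)
Lemma EO_normal s t : Ogrp s -> EO t -> EO (s *m t *m minv s).
Proof.
move=> sO Et.
have adT : admissible (setT : set R) setT by [].
have sT : @Orel R n setT setT s by [].
have := EOrel_EO ideal_setT ideal_setT (Orel_comm hn adT sT Et).
move=> /EOM /(_ Et); rewrite /mcomm mulmx_minvK //; exact: EO_GL.
Qed.

Section CongruenceModE.
Variables (I J : set R).
Hypothesis IJ : admissible I J.
Local Notation E := (@EOrel R n I J).
Let II : is_ideal I. Proof. by case: IJ => -[]. Qed.
Let JJ : is_ideal J. Proof. by case: IJ => -[]. Qed.

Definition central_mod x := EO x /\ forall z, EO z -> E (mcomm x z).

Lemma mcomm_centralM x a c : central_mod x -> EO a -> EO c ->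
  E (mcomm (x *m a) c *m minv (mcomm a c)).
Proof.
move=> [Ex xE] Ea Ec; have Eac := mcomm_EO Ea Ec.
have -> : mcomm (x *m a) c *m minv (mcomm a c)
    = mcomm x (mcomm a c) *m mcomm a c *m mcomm x c *m minv (mcomm a c).
  have xG := EO_GL Ex; have aG := EO_GL Ea; have cG := EO_GL Ec; have acG := EO_GL Eac.
  rewrite mcommK //; congr (_ *m _).
  by rewrite /mcomm minvM // !mulmxA !(mulmx_minvK _ xG) (mulmx_minvK _ cG).
rewrite -(mulmxA (mcomm x _)) -(mulmxA (mcomm x _)).
by apply: EOrelM => //; [exact: xE | apply: EOrelJ => //; exact: xE].
Qed.

Lemma minv_mcomm a b : EO a -> EO b -> minv (mcomm a b) = mcomm b a.
Proof.
move=> /EO_GL aG /EO_GL bG; rewrite /mcomm !minvM ?minvK //; try by do ?[apply: GLM|apply: GLV].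
by rewrite !mulmxA.
Qed.

Lemma mcomm_central2 x y a b : central_mod x -> central_mod y -> EO a -> EO b ->
  E (mcomm (x *m a) (y *m b) *m minv (mcomm a b)).
Proof.
move=> xC yC Ea Eb; have Ex := xC.1; have Ey := yC.1.
have Eyb := EOM Ey Eb; have Exa := EOM Ex Ea.
have Eayb := mcomm_EO Ea Eyb; have Eba := mcomm_EO Eb Ea.
rewrite -[mcomm (x *m a) _](mulmx_minvK (s := mcomm a (y *m b))); last exact: EO_GL.
rewrite -mulmxA; apply: EOrelM => //; first exact: mcomm_centralM.
have := EOrelV II JJ (mcomm_centralM yC Eb Ea).
have G1 := EO_GL (mcomm_EO Eyb Ea); have G2 := EO_GL Eba.
rewrite minvM ?minvK //; last exact: GLV.
rewrite (minv_mcomm Eyb Ea) (minv_mcomm Ea Eb) => /(EOrelJ (EOV Eba)).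
move: (mcomm b a) G2 (mcomm a _) => p pG q.
by rewrite minvK // !mulmxA minv_mulmx // mul1mx.
Qed.

(** For s in CO(R,I,J) and a in EO, the commutator [s,a] is central in EO
    modulo EO(R,I,J). As s a s^-1 = [s,a] a, conjugation by s fixes modulo
    EO(R,I,J) each commutator [a,b] of EO, and these suffice because EO is
    perfect. *)
Theorem COrel_comm s t : COrel I J s -> EO t -> E (mcomm s t).
Proof.
move=> [sO sC]; have sG : GL s by case: sO.
have xC a : EO a -> central_mod (mcomm s a).
  move=> Ea; split.
    by rewrite /mcomm; apply: EOM; [exact: EO_normal | exact: EOV].
  by move=> z Ez; apply: Orel_comm => //; apply: sC; exists a.
apply: comm_EOrel_ind => // i v hi vi.
suff [] : [set t | EO t /\ E (mcomm s t)] (esd (ev i) v) by [].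
apply: EO_perfect hi vi.
  split; first by split; [exact: EO1 | rewrite /mcomm mulmx1 mulmx_minv // minv1 mulmx1; exact: EOrel1].
  move=> a b [Ea Ra] [Eb Rb]; split; first exact: EOM.
  by rewrite mcommMr //; [apply: EOrelM => //; apply: EOrelJ | exact: EO_GL | exact: EO_GL].
move=> a b Ea Eb; split; first exact: mcomm_EO.
have := mcomm_central2 (xC a Ea) (xC b Eb) Ea Eb.
have aG := EO_GL Ea; have bG := EO_GL Eb; have abG := EO_GL (mcomm_EO Ea Eb).
rewrite !mcommK //; congr (E _); rewrite [in RHS]/mcomm -/(mcomm a b); congr (_ *m _).
rewrite /mcomm !minvM //; try by do ?[apply: GLM|apply: GLV].
by rewrite !minvK // !mulmxA !(mulmx_minvK _ sG).
Qed.

End CongruenceModE.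
End Perfect.

(** * The level of a subgroup normalized by EO *)

Section Level.
Context {R : comNzRingType} {n : nat} (hn : (3 <= n)%N).
Variable H : set 'M[R]_(n.*2.+1).
Implicit Types (i j k l m p q : Theta n) (u v w : 'cV[R]_(n.*2.+1)) (s t g h : 'M[R]_(n.*2.+1)) (x y r : R).
Local Notation GL := (@GL R n.*2.+1).
Local Notation EO := (EO R n).
Local Notation Ogrp := (Ogrp R n).

Hypothesis HO : is_subgroup Ogrp H.
Hypothesis HJ : forall g h, EO g -> H h -> H (g *m h *m minv g).

Let H1 : H 1%:M. Proof. by case: HO. Qed.
Let HM s t : H s -> H t -> H (s *m t). Proof. by case: HO => _ _ + _; apply. Qed.
Let HV s : H s -> H (minv s). Proof. by case: HO => _ _ _; apply. Qed.
Let H_Ogrp s : H s -> Ogrp s. Proof. by case: HO => + _ _ _; apply. Qed.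
Let H_GL s : H s -> GL s. Proof. by move/H_Ogrp => []. Qed.

Lemma H_cancell s t : H s -> H (s *m t) -> H t.
Proof.
move=> Hs Hst; rewrite -[t]mul1mx -(minv_mulmx (H_GL Hs)) -mulmxA.
by apply: HM => //; apply: HV.
Qed.

Lemma H_cancelr s t : H s -> H (t *m s) -> H t.
Proof.
move=> Hs Hst; rewrite -[t](mulmxK_minv _ (H_GL Hs)).
by apply: HM => //; apply: HV.
Qed.

Definition short_level x := forall i k, i != th0 n -> k != th0 n -> k != i -> k != rev_ord i ->
  H (esd (ev i) (x *: ev k)).

Definition extra_level x := forall i, i != th0 n -> H (esd (ev i) (x *: ev (th0 n))).

Lemma H_esdB i v v' : i != th0 n -> v (rev_ord i) 0 = 0 -> v' (rev_ord i) 0 = 0 ->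
  H (esd (ev i) v) -> H (esd (ev i) v') -> H (esd (ev i) (v - v')).
Proof.
move=> hi vi vi' Hv Hv'; have b := bpair_evr hi vi; have b' := bpair_evr hi vi'.
rewrite -esdD ?quadQ_ev ?bpairNr ?b' ?oppr0 // -minv_esd ?quadQ_ev //.
by apply: HM => //; apply: HV.
Qed.

Lemma H_act i f (y v : 'cV[R]_(n.*2.+1)) : f != th0 n -> y (rev_ord f) 0 = 0 -> i != th0 n ->
  f != rev_ord i -> y (rev_ord i) 0 = 0 ->
  H (esd (ev i) v) -> H (esd (ev i) (esd (ev f) y *m v)).
Proof.
move=> hf yf hi nfi yi Hv; have b := bpair_evr hf yf.
rewrite -esd_conj_fix ?quadQ_ev //.
- by rewrite -minv_esd ?quadQ_ev //; apply: HJ => //; apply: esd_EO.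
- by rewrite bpair_ev //; ev_simp.
- exact: bpair_evr.
Qed.

Lemma short_step i k q x r : i != th0 n -> k != th0 n -> k != i -> k != rev_ord i ->
  q != th0 n -> q != i -> q != rev_ord i -> q != k -> q != rev_ord k ->
  H (esd (ev i) (x *: ev k)) -> H (esd (ev i) ((r * x) *: ev q)).
Proof.
move=> hi hk nki nki' hq nqi nqi' nqk nqk' Hx.
have hk' := rev_hb hk; have hi' := rev_hb hi.
have n1 : rev_ord k != rev_ord i by ord_neq.
rewrite (_ : _ *: _ = esd (ev (rev_ord k)) ((- r) *: ev q) *m (x *: ev k) - x *: ev k).
  apply: H_esdB => //; last first.
    by apply: H_act => //; rewrite mxE evE; ev_simp; ring.
  by ev_simp; ring.
  by rewrite esdE !bpairE !bpair_ev //; ev_simp; ring.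
rewrite esdE !bpairE !bpair_ev // quadQ_ev //.
by apply/colP => a; ev_simp; ring.
Qed.

Lemma short_any i k q x r : i != th0 n -> k != th0 n -> k != i -> k != rev_ord i ->
  q != th0 n -> q != i -> q != rev_ord i ->
  H (esd (ev i) (x *: ev k)) -> H (esd (ev i) ((r * x) *: ev q)).
Proof.
move=> hi hk nki nki' hq nqi nqi' Hx.
have [m [hm nmi nmi' nmk nmk']] := third_index i k hn.
have Hm := short_step (1) hi hk nki nki' hm nmi nmi' nmk nmk' Hx.
rewrite mul1r in Hm.
have [qk|nqk] := eqVneq q k.
  by apply: (short_step r hi hm) Hm => //; rewrite qk; ord_neq.
have [qk|nqk'] := eqVneq q (rev_ord k).
  by apply: (short_step r hi hm) Hm => //; rewrite qk; ord_neq.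
exact: (short_step r hi hk).
Qed.

Lemma short_swap i k x : i != th0 n -> k != th0 n ->
  H (esd (ev i) (x *: ev k)) -> H (esd (ev k) ((- x) *: ev i)).
Proof.
move=> hi hk; rewrite esd_swap ?quadQZ ?quadQ_ev ?mulr0 // esdZ.
by rewrite scalerN scaleNr.
Qed.

Lemma short_level_gen i k x r : i != th0 n -> k != th0 n -> k != i -> k != rev_ord i ->
  H (esd (ev i) (x *: ev k)) -> short_level (r * x).
Proof.
move=> hi hk nki nki' Hx p q hp hq nqp nqp'.
have [l [hl nli nli' nlp nlp']] := third_index i p hn.
have := short_any (1) hi hk nki nki' hl nli nli' Hx; rewrite mul1r.
have nil : i != l by ord_neq.
have nil' : i != rev_ord l by ord_neq.
have npl : p != l by ord_neq.
have npl' : p != rev_ord l by ord_neq.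
move=> /(short_swap hi hl) /(short_any (1) hl hi nil nil' hp npl npl').
rewrite mul1r => /(short_swap hl hp); rewrite opprK.
exact: (short_any r hp hl).
Qed.

(** Acting on v with two transvections whose vectors are orthogonal to e_l
    isolates one coordinate. *)
Lemma short_extract l v m : l != th0 n -> v (rev_ord l) 0 = 0 -> H (esd (ev l) v) ->
  m != th0 n -> m != l -> m != rev_ord l -> short_level (v m 0).
Proof.
move=> hl vl Hv hm nml nml'.
have [k [hk nkl nkl' nkm nkm']] := third_index l m hn.
have hk' := rev_hb hk; have hl' := rev_hb hl; have hm' := rev_hb hm.
have n1 : rev_ord k != rev_ord l by ord_neq.
have H2 := @H_act l (rev_ord k) (ev (rev_ord m)) v hk' _ hl n1 _ Hv.
have {H2} : H (esd (ev l) (v m 0 *: ev (rev_ord k) - v k 0 *: ev (rev_ord m))).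
  rewrite (_ : _ - _ = esd (ev (rev_ord k)) (ev (rev_ord m)) *m v - v); last first.
    rewrite esdE !bpair_ev // quadQ_ev // !rev_ordK.
    by apply/colP => a; rewrite !mxE; ring.
  apply: H_esdB => //; last by apply: H2; ev_simp.
  by rewrite esdE !bpair_ev // quadQ_ev //; ev_simp; rewrite vl; ring.
set v' := _ - _ => Hv'.
have H2 := @H_act l k (ev (rev_ord m)) v' hk _ hl nkl' _ Hv'.
have : H (esd (ev l) ((- v m 0) *: ev (rev_ord m))).
  rewrite (_ : _ *: _ = esd (ev k) (ev (rev_ord m)) *m v' - v'); last first.
    rewrite esdE !bpair_ev // quadQ_ev // !rev_ordK /v'.
    by apply/colP => a; ev_simp; ring.
  apply: H_esdB => //; last by apply: H2; ev_simp.
    by rewrite esdE !bpair_ev // quadQ_ev // /v'; ev_simp; ring.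
  by rewrite /v'; ev_simp; ring.
move=> /(short_level_gen (-1)); rewrite mulrNN mul1r; apply => //; ord_neq.
Qed.

Let Hmon : mxmonoid H. Proof. by split. Qed.

Lemma extra_extract_same l v : l != th0 n -> v (rev_ord l) 0 = 0 -> H (esd (ev l) v) ->
  H (esd (ev l) (v (th0 n) 0 *: ev (th0 n))).
Proof.
move=> hl vl Hv; have hl' := rev_hb hl; have bv := bpair_evr hl vl.
pose v' := v - v (th0 n) 0 *: ev (th0 n) + (- v l 0) *: ev l.
have v'l : v' (rev_ord l) 0 = 0 by rewrite /v'; ev_simp; rewrite vl; ring.
have Hv' : H (esd (ev l) v').
  apply: (@esd_ev_gen _ _ H short_level [set 0]) => //.
  - by move=> k c hk nkl nkl'; apply.
  - by move=> c ->; rewrite scale0r esd0.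
  split; last by rewrite /v' /=; ev_simp; ring.
  have sl0 : short_level 0 by move=> *; rewrite scale0r esd0.
  move=> k hk; have [->|nkl] := eqVneq k l.
    by rewrite (_ : v' l 0 = 0) //; rewrite /v'; ev_simp; ring.
  have [->|nkl'] := eqVneq k (rev_ord l); first by rewrite v'l.
  rewrite (_ : v' k 0 = v k 0); last by rewrite /v'; ev_simp; ring.
  exact: (short_extract hl vl).
rewrite (_ : _ *: _ = v + (- v l 0) *: ev l - v'); last first.
  by rewrite /v'; apply/colP => a; rewrite !mxE; ring.
apply: H_esdB => //; first by ev_simp; rewrite vl; ring.
by rewrite esd_shift // quadQ_ev.
Qed.

(** Conjugating by [esd e_l (a e_-i)] replaces e_i by e_i + a e_l; by [esd_addl]
    the new transvection involves y^2, which is the source of the condition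
    that squares of elements of J are in I. *)
Lemma extra_step i l y a : i != th0 n -> l != th0 n -> l != i -> l != rev_ord i ->
  H (esd (ev i) (y *: ev (th0 n))) ->
  short_level (a * y ^+ 2) /\ H (esd (ev l) ((a * y) *: ev (th0 n))).
Proof.
move=> hi hl nli nli' Hy; have hi' := rev_hb hi; have hl' := rev_hb hl.
have ql := @quadQ_ev R n l hl; have qi := @quadQ_ev R n i hi.
have ha : (a *: ev (rev_ord i)) (rev_ord l) 0 = 0 by ev_simp; ring.
have := HJ (esd_EO hl ha) Hy.
have bi0 : bpair (ev i) (ev (th0 n)) = 0 :> R by rewrite bpair_ev //; ev_simp.
have bl0 : bpair (ev l) (ev (th0 n)) = 0 :> R by rewrite bpair_ev //; ev_simp.
have bil : bpair (ev i) (ev l) = 0 :> R by rewrite bpair_ev //; ev_simp.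
rewrite (esd_conj (ev i) (y *: ev (th0 n)) (isometry_esd ql (bpair_evr hl ha))).
rewrite mulmxK_minv; last exact: EO_GL (esd_EO hl ha).
have -> : esd (ev l) (a *: ev (rev_ord i)) *m ev i = ev i + a *: ev l.
  by rewrite esdE !bpairE !bpair_ev //; apply/colP => b; ev_simp; rewrite quadQ_ev //; ring.
have -> : esd (ev l) (a *: ev (rev_ord i)) *m (y *: ev (th0 n)) = y *: ev (th0 n).
  by rewrite esdE !bpairE !bpair_ev //; apply/colP => b; ev_simp; rewrite ?quadQ_ev //; ring.
rewrite esd_addl ?quadQZ ?ql ?qi ?mulr0 ?bpairZr ?bpairZl ?bi0 ?bl0 ?bil ?mulr0 //.
rewrite quadQ_ev0 mulr1.
set v : 'cV[R]_(n.*2.+1) := (- (a * y ^+ 2)) *: ev i + (a * y) *: ev (th0 n).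
have vl : v (rev_ord l) 0 = 0 by rewrite /v; ev_simp; ring.
have -> : esd (ev i) (y ^+ 2 *: (a *: ev l)) *m esd (ev i) (y *: ev (th0 n)) *m
    esd (a *: ev l) (y *: ev (th0 n)) = esd (ev i) (y *: ev (th0 n)) *m esd (ev l) v.
  rewrite esdD ?bpairZr ?bi0 ?bil ?mulr0 // addrC -esdD ?bpairZr ?bi0 ?bil ?mulr0 // -mulmxA.
  congr (_ *m _); rewrite esdZ esd_swap ?quadQZ ?qi ?ql ?mulr0 // !esdZ.
  have bli : bpair (ev l) (ev i) = 0 :> R by rewrite bpairC.
  rewrite esdD // ?bpairZr ?bpairNr ?bli ?bl0 ?oppr0 ?mulr0 //.
  by congr esd; apply/colP => b; rewrite !mxE; ring.
move=> /(H_cancell Hy) Hv.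
have nil : i != l by ord_neq.
have nil' : i != rev_ord l by ord_neq.
split.
  have := short_extract hl vl Hv hi nil nil'.
  rewrite (_ : v i 0 = - (a * y ^+ 2)); last by rewrite /v; ev_simp; ring.
  move=> /(_ l i hl hi nil nil')/(short_level_gen (-1) hl hi nil nil').
  by rewrite mulrNN mul1r.
have := extra_extract_same hl vl Hv.
by rewrite (_ : v (th0 n) 0 = a * y) // /v; ev_simp; ring.
Qed.

Lemma extra_level_gen i y r : i != th0 n -> H (esd (ev i) (y *: ev (th0 n))) ->
  short_level (y ^+ 2) /\ extra_level (r * y).
Proof.
move=> hi Hy; split.
  have [l [hl nli nli' _ _]] := third_index i i hn.
  by have [] := extra_step 1 hi hl nli nli' Hy; rewrite mul1r.
move=> p hp; have [l [hl nli nli' nlp nlp']] := third_index i p hn.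
have [_] := extra_step 1 hi hl nli nli' Hy; rewrite mul1r => Hl.
have npl : p != l by ord_neq.
have npl' : p != rev_ord l by ord_neq.
by have [] := extra_step r hl hp npl npl' Hl.
Qed.

Lemma extra_extract l v : l != th0 n -> v (rev_ord l) 0 = 0 -> H (esd (ev l) v) ->
  extra_level (v (th0 n) 0).
Proof.
move=> hl vl /(extra_extract_same hl vl)/(extra_level_gen (1) hl)[_].
by rewrite mul1r.
Qed.

Lemma hb_index : exists i : Theta n, i != th0 n.
Proof. by have [m [hm _ _ _ _]] := third_index ord0 ord0 hn; exists m. Qed.

Lemma short_level_ideal : is_ideal short_level.
Proof.
split; first by move=> *; rewrite scale0r esd0.
- move=> x y Hx Hy i k hi hk nki nki'.
  rewrite scalerDl -esdD ?quadQ_ev //; first by apply: HM; [apply: Hx | apply: Hy].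
    by rewrite bpair_ev //; ev_simp; ring.
  by rewrite bpair_ev //; ev_simp; ring.
- move=> a x Hx; have [i hi] := hb_index.
  have [m [hm nmi nmi' _ _]] := third_index i i hn.
  exact: (short_level_gen a hi hm nmi nmi' (Hx i m hi hm nmi nmi')).
Qed.

Lemma extra_level_ideal : is_ideal extra_level.
Proof.
split; first by move=> *; rewrite scale0r esd0.
- move=> x y Hx Hy i hi; have hi' := rev_hb hi.
  rewrite scalerDl -esdD ?quadQ_ev //; first by apply: HM; [apply: Hx | apply: Hy].
    by rewrite bpair_ev //; ev_simp; ring.
  by rewrite bpair_ev //; ev_simp; ring.
- move=> a x Hx; have [i hi] := hb_index.
  by have [] := extra_level_gen a hi (Hx i hi).
Qed.

Lemma level_admissible : admissible short_level extra_level.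
Proof.
have [i hi] := hb_index; have hi' := rev_hb hi.
have [m [hm nmi nmi' _ _]] := third_index i i hn.
have hm' := rev_hb hm.
have nmi2 : rev_ord m != rev_ord i by ord_neq.
split.
- by split; [exact: short_level_ideal | exact: extra_level_ideal].
- move=> x Hx.
  have : H (esd (ev i) (esd (ev m) (ev (th0 n)) *m (x *: ev (th0 n)))).
    by apply: H_act => //; [ev_simp | ev_simp | exact: Hx].
  rewrite (_ : _ *m _ = x *: ev (th0 n) + (2%:R * x) *: ev m); last first.
    rewrite esdE !bpairE bpair_ev // quadQ_ev0; apply/colP => a; ev_simp; ring.
  move=> /short_extract -/(_ m); rewrite (_ : fun_of_matrix _ m 0 = 2%:R * x); last by ev_simp; ring.
  by apply => //; ev_simp; ring.
- by move=> x Hx; have [] := extra_level_gen 0 hi (Hx i hi).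
- move=> x Hx.
  have : H (esd (ev i) (esd (ev (rev_ord m)) (ev (th0 n)) *m (x *: ev m))).
    by apply: H_act => //; [ev_simp | ev_simp | exact: Hx].
  rewrite (_ : _ *m _ = x *: ev m - x *: ev (th0 n) - x *: ev (rev_ord m)); last first.
    rewrite esdE !bpairE (bpairC (ev (th0 n))) !bpair_ev // quadQ_ev0.
    by apply/colP => a; ev_simp; ring.
  move=> /extra_extract; rewrite (_ : fun_of_matrix _ (th0 n) 0 = - x); last by ev_simp; ring.
  move=> K; rewrite -[x]opprK -mulN1r; case: extra_level_ideal => _ _; apply.
  by apply: K => //; ev_simp; ring.
Qed.

Lemma EOrel_level : EOrel short_level extra_level `<=` H.
Proof.
have [Is Ie] := (short_level_ideal, extra_level_ideal).
suff : EOrel short_level extra_level `<=` [set s | EO s /\ H s] by move=> h s /h[].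
apply: EOrel_min.
- split; first by move=> s [].
  + by split=> //; exact: EO1.
  + by move=> s t [Es Hs] [Et Ht]; split; [exact: EOM | exact: HM].
  + by move=> s [Es Hs]; split; [exact: EOV | exact: HV].
- move=> g h Eg [Eh Hh]; split; last exact: HJ.
  by apply: EOM; [exact: EOM | exact: EOV].
move=> s sX; split.
  have [i [v [hi _ vi ->]]] := elementary_esd Is Ie sX; exact: esd_EO.
case: sX => [[i [j [x [hi hj [nij nij'] Hx ->]]]]|[i [x [hi Hx ->]]]].
  rewrite Tshort_esd //; have hj' := rev_hb hj; apply: Hx => //; ord_neq.
rewrite Textra_esd // -mulN1r; case: Ie => _ _ JM; exact: (JM (-1) x Hx i hi).
Qed.

End Level.

(** * Matrix entries of a normalized subgroup *)

Section Entries.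
Context {R : comNzRingType} {n : nat} (hn : (3 <= n)%N).
Variable H : set 'M[R]_(n.*2.+1).
Implicit Types (a b c i j k l m p q : Theta n) (u v w : 'cV[R]_(n.*2.+1)) (s t g h : 'M[R]_(n.*2.+1)) (x y r : R).
Local Notation GL := (@GL R n.*2.+1).
Local Notation EO := (EO R n).
Local Notation Ogrp := (Ogrp R n).

Hypothesis HO : is_subgroup Ogrp H.
Hypothesis HJ : forall g h, EO g -> H h -> H (g *m h *m minv g).

Let H1 : H 1%:M. Proof. by case: HO. Qed.
Let HM s t : H s -> H t -> H (s *m t). Proof. by case: HO => _ _ + _; apply. Qed.
Let HV s : H s -> H (minv s). Proof. by case: HO => _ _ _; apply. Qed.
Let H_Ogrp s : H s -> Ogrp s. Proof. by case: HO => + _ _ _; apply. Qed.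
Let H_GL s : H s -> GL s. Proof. by move/H_Ogrp => []. Qed.

Local Notation I := (short_level H).
Local Notation J := (extra_level H).

Let II : is_ideal I. Proof. exact: short_level_ideal. Qed.
Let JJ : is_ideal J. Proof. exact: extra_level_ideal. Qed.
Let ID x y : I x -> I y -> I (x + y). Proof. by case: II => _ + _; apply. Qed.
Let JD x y : J x -> J y -> J (x + y). Proof. by case: JJ => _ + _; apply. Qed.
Let IM x y : I y -> I (x * y). Proof. by case: II => _ _; apply. Qed.
Let JM x y : J y -> J (x * y). Proof. by case: JJ => _ _; apply. Qed.
Let IN x : I x -> I (- x). Proof. by rewrite -mulN1r; apply: IM. Qed.
Let JN x : J x -> J (- x). Proof. by rewrite -mulN1r; apply: JM. Qed.
Let IB x y : I x -> I y -> I (x - y). Proof. by move=> Ix Iy; apply/ID/IN. Qed.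
Let JB x y : J x -> J y -> J (x - y). Proof. by move=> Ix Iy; apply/JD/JN. Qed.
Let IJ x : I x -> J x. Proof. by have [_ _ _] := level_admissible hn HO HJ; apply. Qed.

(** The action of the bivector x e_a ^ e_b + y e_a ^ e_c + r e_b ^ e_c. *)
Definition esd3 a b c x y r : 'M[R]_(n.*2.+1) :=
  esd (ev a) (x *: ev b) *m esd (ev a) (y *: ev c) *m esd (ev b) (r *: ev c).

Definition indep3 a b c :=
  [/\ [/\ a != th0 n, b != th0 n & c != th0 n], b != a /\ b != rev_ord a,
      c != a /\ c != rev_ord a & c != b /\ c != rev_ord b].

Lemma esd3_EO a b c x y r : indep3 a b c -> EO (esd3 a b c x y r).
Proof.
move=> [[ha hb hc] [nba nba'] [nca nca'] [ncb ncb']].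
have ha' := rev_hb ha; have hb' := rev_hb hb.
by do ?apply: EOM; apply: esd_EO => //; ev_simp; ring.
Qed.

Lemma esd3E a b c x y r w : indep3 a b c ->
  esd3 a b c x y r *m w = w
    + x *: (w (rev_ord b) 0 *: ev a - w (rev_ord a) 0 *: ev b)
    + y *: (w (rev_ord c) 0 *: ev a - w (rev_ord a) 0 *: ev c)
    + r *: (w (rev_ord c) 0 *: ev b - w (rev_ord b) 0 *: ev c).
Proof.
move=> [[ha hb hc] [nba nba'] [nca nca'] [ncb ncb']].
have ha' := rev_hb ha; have hb' := rev_hb hb; have hc' := rev_hb hc.
rewrite -!mulmxA !esdE !bpairE !bpair_ev // !quadQ_ev //.
by apply/colP => i; ev_simp; ring.
Qed.

(** Since s is an isometry, the row i of s gives the coordinates of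
    s^-1 e_-i. *)
Lemma minv_coord s i j : Ogrp s -> i != th0 n -> j != th0 n ->
  (minv s *m ev (rev_ord i)) (rev_ord j) 0 = s i j.
Proof.
move=> [sG sQ] hi hj; have hi' := rev_hb hi.
rewrite -bpair_ev // -(bpair_isometry _ _ sQ) mulmxA mulmx_minv // mul1mx bpairC.
by rewrite bpair_ev // rev_ordK mulmx_ev.
Qed.

(** The coefficients are those of the contraction of e_a ^ e_b ^ e_c with the
    row a of s, and contracting once more with the same row gives 0; so the bivector
    kills s^-1 e_-a. *)
Lemma esd3_fix s a b c : Ogrp s -> indep3 a b c ->
  s *m esd3 a b c (s a c) (- s a b) (s a a) *m minv s *m ev (rev_ord a) = ev (rev_ord a).
Proof.
move=> sO abc; have [[ha hb hc] _ _ _] := abc; have sG : GL s by case: sO.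
rewrite -mulmxA -mulmxA esd3E // !minv_coord //.
set z := minv s *m _; rewrite (_ : _ + _ = z).
  by rewrite mulmxA mulmx_minv // mul1mx.
by clearbody z; apply/colP => i; rewrite !mxE; ring.
Qed.

(** Write xi for s g s^-1 and t for [esd e_-a y]. The element is the commutator
    of xi g^-1, which is in H, and g t g^-1; the factors g cancel because xi
    fixes e_-a. *)
Lemma esd3_comm s a b c (y : 'cV[R]_(n.*2.+1)) : H s -> indep3 a b c -> y a 0 = 0 ->
  let g := esd3 a b c (s a c) (- s a b) (s a a) in
  (s *m g *m minv s *m y) a 0 = 0 /\
  H (esd (ev (rev_ord a)) (s *m g *m minv s *m y) *m (g *m esd (ev (rev_ord a)) (- y) *m minv g)).
Proof.
move=> Hs abc ya g; have [[ha hb hc] _ _ _] := abc; have ha' := rev_hb ha.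
have sO := H_Ogrp Hs; have sG := H_GL Hs.
have Eg : EO g := esd3_EO _ _ _ abc; have gG := EO_GL Eg.
have := esd3_fix sO abc; rewrite -/g; clearbody g => gfix.
set xi := s *m g *m minv s in gfix *; pose t := esd (ev (rev_ord a)) y.
have ya' : y (rev_ord (rev_ord a)) 0 = 0 by rewrite rev_ordK.
have by' := bpair_evr ha' ya'; have qa := @quadQ_ev R n _ ha'.
have Et : EO t by apply: esd_EO.
have VtE : minv t = esd (ev (rev_ord a)) (- y) by rewrite minv_esd.
have xit : isometry xi -> xi *m t = esd (ev (rev_ord a)) (xi *m y) *m xi.
  by move=> xiO; rewrite (esd_conj _ _ xiO) gfix.
have tG := EO_GL Et.
have xiO : isometry xi.
  by move=> u; rewrite -!mulmxA sO.2 (EO_O Eg).2 -sO.2 mulmxA mulmx_minv // mul1mx.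
have xiG : GL xi by do 2?apply: GLM => //; apply: GLV.
have Hh : H (xi *m minv g).
  by rewrite /xi -2!mulmxA; apply: HM => //; rewrite mulmxA; apply: HJ => //; apply: HV.
clearbody xi t.
split.
  rewrite -[a in LHS]rev_ordK -bpair_ev // -gfix.
  by rewrite (bpair_isometry _ _ xiO) bpair_ev // rev_ordK.
have := HM Hh (HJ (EOM (EOM Eg Et) (EOV Eg)) (HV Hh)).
congr (H _); rewrite -VtE.
have -> : esd (ev (rev_ord a)) (xi *m y) = xi *m t *m minv xi.
  by rewrite xit // mulmxK_minv.
have tgG : GL (g *m t) by apply: GLM.
have vG : GL (minv g) by apply: GLV.
rewrite !minvM // ?minvK // !mulmxA.
by rewrite !(mulmx_minvK _ gG).
Qed.

(** Take y = e_j in [esd3_comm]. The commutator with t = [esd e_-i e_-j] removes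
    the factor A, which commutes with t, and the rest is the transvection
    along e_-i by - s_ij e_b. *)
Lemma entry_apart s i j : H s -> i != th0 n -> j != th0 n -> j != i -> j != rev_ord i -> I (s i j).
Proof.
move=> Hs hi hj nji nji'.
have [b [hb nbi nbi' nbj nbj']] := third_index i j hn.
have njb : j != b by ord_neq.
have njb' : j != rev_ord b by ord_neq.
have abc : indep3 i b j by split.
have hi' := rev_hb hi; have hj' := rev_hb hj; have hb' := rev_hb hb.
have ej : ev j i 0 = 0 :> R by ev_simp.
have := esd3_comm Hs abc ej => /=.
set g := esd3 _ _ _ _ _ _; have Eg : EO g := esd3_EO _ _ _ abc; have gG := EO_GL Eg.
have gO : isometry g := (EO_O Eg).2.
have gj : g *m ev j = ev j.
  by rewrite esd3E //; apply/colP => k; ev_simp; ring.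
set p := s i j; set q := - s i b in g Eg gG gO gj *.
have gi : g *m ev (rev_ord i) = ev (rev_ord i) - p *: ev b - q *: ev j.
  by rewrite esd3E //; apply/colP => k; ev_simp; rewrite -/p; ring.
(* The factor of [esd3_comm] that depends only on the row i of s. *)
have -> : g *m esd (ev (rev_ord i)) (- ev j) *m minv g = esd (g *m ev (rev_ord i)) (- ev j).
  by rewrite (esd_conj _ _ gO) mulmxK_minv // mulmxN gj.
rewrite gi; set f := _ - q *: ev j; set e := _ *m ev j => -[ei HAB].
have n1 : j != rev_ord i by ord_neq.
have n2 : b != rev_ord i by ord_neq.
pose Y : 'cV[R]_(n.*2.+1) := ev j + ev (rev_ord i); pose V := ev (rev_ord i) - p *: ev b.
pose t := esd (ev (rev_ord i)) (ev (rev_ord j)) : 'M[R]_(n.*2.+1).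
have Et : EO t by apply: esd_EO => //; ev_simp.
have qi := @quadQ_ev R n _ hi'; have qj := @quadQ_ev R n _ hj; have qb := @quadQ_ev R n _ hb.
have bij : bpair (ev (rev_ord i)) (ev j) = 0 :> R by rewrite bpair_ev //; ev_simp.
have bib : bpair (ev (rev_ord i)) (ev b) = 0 :> R by rewrite bpair_ev //; ev_simp.
have bjb : bpair (ev j) (ev b) = 0 :> R by rewrite bpair_ev //; ev_simp.
have bii' : bpair (ev (rev_ord i)) (ev (rev_ord j)) = 0 :> R by rewrite bpair_ev //; ev_simp.
have tO : isometry t := (EO_O Et).2.
have qf : quadQ f = 0 by rewrite /f -gi gO.
have fE : f = V - q *: ev j by [].
have qV : quadQ V = 0 by rewrite !bpairE qi qb bib; ring.
have bjV : bpair (ev j) V = 0 by rewrite bpairDr bpairNr bpairZr bjb bpairC bij; ring.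
have biV : bpair (ev (rev_ord i)) V = 0.
  by rewrite bpairDr bpairNr bpairZr bpairxx qi bib; ring.
have qY : quadQ Y = 0 by rewrite !bpairE qi qj bpairC bij; ring.
have YV : bpair Y V = 0 by rewrite bpairDl bjV biV; ring.
have tj : t *m ev j = Y.
  by rewrite esdE !bpair_ev // quadQ_ev //; apply/colP => k; rewrite /Y; ev_simp; ring.
have tf : t *m f = V + (- q) *: Y.
  rewrite esdE !bpair_ev // quadQ_ev //; apply/colP => k; rewrite /f /V /Y; ev_simp; ring.
have := HJ Et HAB.
set A := esd _ e in HAB *.
have -> : t *m (A *m esd f (- ev j)) *m minv t = A *m (t *m esd f (- ev j) *m minv t).
  have be : bpair (ev (rev_ord i)) e = 0 by rewrite bpair_ev // rev_ordK.
  rewrite !mulmxA; congr (_ *m _ *m _).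
  by rewrite esdD // addrC -esdD.
have bfj : bpair f (ev j) = 0.
  by rewrite fE bpairDl bpairNl bpairZl bpairxx qj bpairC bjV; ring.
have bfj' : bpair f (- ev j) = 0 by rewrite bpairNr bfj oppr0.
move=> HtAB.
have : H (esd f (ev j) *m (t *m esd f (- ev j) *m minv t)).
  apply: (H_cancell HO HAB); rewrite -mulmxA [in X in _ *m X]mulmxA.
  by rewrite esdVK // mul1mx.
rewrite (esd_conj _ _ tO) mulmxK_minv; last exact: EO_GL.
(* The factors become transvections along e_j and along Y = e_j + e_-i; by
   [esd_addl] the parts along e_j cancel. *)
rewrite tf mulmxN tj -(esd_swap qY); last by rewrite -tf tO.
have bji : bpair (ev j) (ev (rev_ord i)) = 0 :> R by rewrite bpairC.
rewrite (esd_shift _ qY YV) (esd_addl qj qi bji bjV biV) qV scale0r esd0 mul1mx mulmxA.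
rewrite (esd_swap qf qj) fE opprB addrC esd_shift // ?bpairNr ?bjV ?oppr0 //.
rewrite esdVK // mul1mx (_ : V = (- p) *: ev b + 1 *: ev (rev_ord i)); last first.
  by rewrite /V scale1r scaleNr addrC.
rewrite esd_shift ?bpairZr ?bib ?mulr0 // => Hp.
have nbi2 : b != rev_ord (rev_ord i) by rewrite rev_ordK.
have := short_level_gen hn HO HJ (-1) hi' hb n2 nbi2 Hp.
by rewrite mulrNN mul1r.
Qed.

Lemma esd_row f (y w : 'cV[R]_(n.*2.+1)) k : f != th0 n ->
  (esd (ev f) y *m w) k 0 = w k 0 + bpair y w * (k == f)%:R
    - w (rev_ord f) 0 * y k 0 - quadQ y * w (rev_ord f) 0 * (k == f)%:R.
Proof. by move=> hf; rewrite esdE bpair_ev // !mxE eqxx andbT. Qed.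

Lemma conj_row s f (y : 'cV[R]_(n.*2.+1)) k l : f != th0 n -> y (rev_ord f) 0 = 0 ->
  (esd (ev f) y *m s *m minv (esd (ev f) y)) k l
    = (esd (ev f) y *m (s *m (esd (ev f) (- y) *m ev l))) k 0.
Proof.
by move=> hf yf; rewrite minv_esd ?quadQ_ev ?bpair_evr // !mulmxA mulmx_ev.
Qed.

(* Conjugating s by a root matrix adds to an entry known to lie in the level a
   combination of entries that are to be put there. *)
Section RootConjugates.
Variables (s : 'M[R]_(n.*2.+1)) (i j : Theta n).
Hypotheses (Hs : H s) (hi : i != th0 n) (hj : j != th0 n) (nji : j != i) (nji' : j != rev_ord i).
Let hi' := rev_hb hi.
Let hj' := rev_hb hj.

Lemma short_conj_entry : exists s', [/\ H s', s' j (rev_ord i) = s j (rev_ord i) + s i (rev_ord i)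
  & s' j i = s j i + s i i - s j j - s i j].
Proof.
have yj : (ev (rev_ord i)) (rev_ord j) 0 = 0 :> R by ev_simp.
exists (esd (ev j) (ev (rev_ord i)) *m s *m minv (esd (ev j) (ev (rev_ord i)))); split.
- by apply: HJ => //; apply: esd_EO.
- rewrite conj_row //.
  have -> : esd (ev j) (- ev (rev_ord i)) *m ev (rev_ord i) = ev (rev_ord i) :> 'cV[R]_(n.*2.+1).
    rewrite esdE !bpairE !bpair_ev // quadQ_ev //; apply/colP => k; ev_simp; ring.
  rewrite esd_row // bpair_ev // rev_ordK quadQ_ev // !mulmx_ev; ev_simp; ring.
- rewrite conj_row //.
  have -> : esd (ev j) (- ev (rev_ord i)) *m ev i = ev i - ev j :> 'cV[R]_(n.*2.+1).
    rewrite esdE !bpairE !bpair_ev // ?quadQ_ev //; apply/colP => k; ev_simp; ring.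
  have w k : (s *m (ev i - ev j)) k 0 = s k i - s k j.
    by rewrite mulmxBr mxE [in X in _ + X]mxE !mulmx_ev.
  rewrite esd_row // bpair_ev // rev_ordK quadQ_ev // !w; ev_simp; ring.
Qed.

Lemma extra_conj_entry : exists s', [/\ H s', s' i (rev_ord j) = s i (rev_ord j) + s i (th0 n) - s i j
  & s' (th0 n) (rev_ord j) = s (th0 n) (rev_ord j) + s (th0 n) (th0 n) - s (th0 n) j
       - s (rev_ord j) (rev_ord j) - s (rev_ord j) (th0 n) + s (rev_ord j) j].
Proof.
have yj : (ev (th0 n)) (rev_ord j) 0 = 0 :> R by ev_simp.
exists (esd (ev j) (ev (th0 n)) *m s *m minv (esd (ev j) (ev (th0 n)))).
have cE : esd (ev j) (- ev (th0 n)) *m ev (rev_ord j) = ev (rev_ord j) + ev (th0 n) - ev j :> 'cV[R]_(n.*2.+1).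
  rewrite esdE !bpairE (bpairC (ev (th0 n))) !bpair_ev // quadQ_ev0.
  apply/colP => k; ev_simp; ring.
have w k : (s *m (ev (rev_ord j) + ev (th0 n) - ev j)) k 0 = s k (rev_ord j) + s k (th0 n) - s k j.
  rewrite mulmxBr mulmxDr mxE [in X in X + _]mxE [in X in _ + X]mxE !mulmx_ev; ring.
split; first by apply: HJ => //; apply: esd_EO.
- rewrite conj_row // cE esd_row // !w; ev_simp; ring.
- rewrite conj_row // cE esd_row // !w; ev_simp; ring.
Qed.
End RootConjugates.

Lemma entry_offdiag s i j : H s -> i != th0 n -> j != i -> I (s i j).
Proof.
move=> Hs hi nji; have hi' := rev_hb hi.
have [m [hm nmi nmi' _ _]] := third_index i i hn.
have hm' := rev_hb hm.
have nim : i != m by ord_neq.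
have nim' : i != rev_ord m by ord_neq.
have nmi2 : rev_ord m != rev_ord i by ord_neq.
have nmi3 : rev_ord m != i by ord_neq.
have [->|hj] := eqVneq j (th0 n).
  have [s' [Hs' e _]] := extra_conj_entry Hs hi hm nmi.
  have -> : s i (th0 n) = s' i (rev_ord m) - s i (rev_ord m) + s i m by rewrite e; ring.
  by apply: ID; [apply: IB|]; apply: entry_apart.
have [->|nji'] := eqVneq j (rev_ord i); last exact: entry_apart.
have [s' [Hs' e _]] := short_conj_entry Hs hi hm nmi nmi'.
have -> : s i (rev_ord i) = s' m (rev_ord i) - s m (rev_ord i) by rewrite e; ring.
by apply: IB; apply: entry_apart => //; ord_neq.
Qed.

Lemma entry_diag_apart s i j : H s -> i != th0 n -> j != th0 n -> j != i -> j != rev_ord i ->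
  I (s i i - s j j).
Proof.
move=> Hs hi hj nji nji'.
have [s' [Hs' _ e]] := short_conj_entry Hs hi hj nji nji'.
have -> : s i i - s j j = s' j i - s j i + s i j by rewrite e; ring.
by apply: ID; [apply: IB|]; apply: entry_offdiag => //; rewrite eq_sym.
Qed.

Lemma entry_diag s i j : H s -> i != th0 n -> j != th0 n -> I (s i i - s j j).
Proof.
move=> Hs hi hj; have [m [hm nmi nmi' nmj nmj']] := third_index i j hn.
have -> : s i i - s j j = (s i i - s m m) + (s m m - s j j) by ring.
by apply: ID; apply: entry_diag_apart => //; ord_neq.
Qed.

Lemma diag_unit s a : H s -> a != th0 n -> I (s a a * minv s a a - 1).
Proof.
move=> Hs ha; have := mulmx_minv (H_GL Hs) => /matrixP /(_ a a).
rewrite !mxE eqxx mulr1n (bigD1 a) //= => e.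
rewrite (_ : _ - 1 = - \sum_(i | i != a) s a i * minv s i a); last by rewrite -e; ring.
apply: IN; apply: big_ind => // [|i nia]; first by case: II.
by rewrite mulrC; apply/IM/entry_offdiag.
Qed.

(** Take y = e_-b in [esd3_comm]. The entries s_ij and s_ib are now known to be in
    I, so modulo H only the part of g with coefficient s_ii is left, and the
    product is a transvection along e_-i whose vector has at 0 the coordinate
    - s_ii s_bb s_0j modulo J. The diagonal entries are units modulo I. *)
Lemma entry_zero s j : H s -> j != th0 n -> J (s (th0 n) j).
Proof.
move=> Hs hj.
have [i [hi nij nij' _ _]] := third_index j j hn.
have [b [hb nbi nbi' nbj nbj']] := third_index i j hn.
have nji : j != i by ord_neq.
have nji' : j != rev_ord i by ord_neq.
have njb : j != b by ord_neq.
have njb' : j != rev_ord b by ord_neq.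
have abc : indep3 i b j by split.
have hi' := rev_hb hi; have hj' := rev_hb hj; have hb' := rev_hb hb.
have nbi2 : rev_ord b != i by ord_neq.
have nbi3 : rev_ord b != rev_ord i by ord_neq.
have sO := H_Ogrp Hs; have sG := H_GL Hs.
have eb : ev (rev_ord b) i 0 = 0 :> R by ev_simp.
have [] := esd3_comm Hs abc eb.
rewrite /=; set p := s i j; set q := - s i b; set r := s i i.
set e := _ *m ev (rev_ord b) => ei.
have Ip : I p by apply: entry_apart.
have Iq : I q by apply: IN; apply: entry_apart.
have e0 : J (e (th0 n) 0 + r * (s b b * s (th0 n) j)).
  rewrite /e -mulmxA -mulmxA esd3E // !minv_coord // !(mulmxDr, mulmxN, =^~scalemxAr).
  rewrite mulmxA mulmx_minv // mul1mx.
  have sev0 k : (s *m ev k) (th0 n) 0 = s (th0 n) k by rewrite mulmx_ev.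
  have Ib k : k != b -> J (s b k) by move=> nkb; apply/IJ/entry_offdiag.
  rewrite (_ : _ + _ = p * (s b b * s (th0 n) i - s b i * s (th0 n) b)
     + q * (s b j * s (th0 n) i - s b i * s (th0 n) j) + r * s (th0 n) b * s b j).
    apply: JD; first apply: JD.
    - by rewrite mulrC; apply/JM/IJ.
    - by rewrite mulrC; apply/JM/IJ.
    - exact/JM/Ib.
  move: (sev0 i) (sev0 b) (sev0 j).
  move: (s *m ev i) (s *m ev b) (s *m ev j) => ui ub uj hui hub huj.
  by rewrite !mxE hui hub huj /=; ev_simp; ring.
move: e e0 ei => e e0 ei.
set m := esd (ev i) (p *: ev b) *m esd (ev i) (q *: ev j).
have esd3E' : esd3 i b j p q r = m *m esd (ev b) (r *: ev j) by [].
set g0 := esd (ev b) (r *: ev j) in esd3E'.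
have nbj2 : (r *: ev j) (rev_ord b) 0 = 0 by ev_simp; ring.
have Eg0 : EO g0 by apply: esd_EO.
have Em : EO m by apply: EOM; apply: esd_EO => //; ev_simp; ring.
have Hm : H m by apply: HM; [apply: Ip | apply: Iq].
have g0O : isometry g0 := (EO_O Eg0).2.
have g0i : g0 *m ev (rev_ord i) = ev (rev_ord i).
  rewrite esdE !bpairE !bpair_ev // quadQ_ev //; apply/colP => k; ev_simp; ring.
have g0b : g0 *m ev (rev_ord b) = ev (rev_ord b) - r *: ev j.
  rewrite esdE !bpairE !bpair_ev // quadQ_ev //; apply/colP => k; ev_simp; ring.
rewrite esd3E'; set A := esd (ev (rev_ord i)) e.
have EA : EO A by apply: esd_EO; rewrite ?rev_ordK.
have -> : m *m g0 *m esd (ev (rev_ord i)) (- ev (rev_ord b)) *m minv (m *m g0)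
    = m *m esd (ev (rev_ord i)) (- ev (rev_ord b) + r *: ev j) *m minv m.
  rewrite minvM; try exact: EO_GL.
  rewrite -(mulmxA m g0) (esd_conj _ _ g0O) g0i mulmxN g0b !mulmxA mulmxK_minv; last exact: EO_GL.
  by rewrite opprB addrC.
set B := esd _ (_ + _) => HAB.
have bi : (- ev (rev_ord b) + r *: ev j) i 0 = 0 by ev_simp; ring.
have : H (A *m B).
  have HmB : H (A *m m *m B) by apply: (H_cancelr HO (HV Hm)); rewrite -!mulmxA in HAB *.
  apply: (H_cancell HO (HJ EA Hm)).
  by rewrite mulmxA (mulmx_minvK _ (EO_GL EA)).
rewrite esdD ?quadQ_ev ?bpair_ev ?rev_ordK // => HC.
have := extra_extract hn HO HJ hi' _ HC; rewrite rev_ordK.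
rewrite mxE ei bi addr0 => /(_ erefl).
rewrite (_ : fun_of_matrix _ _ _ = e (th0 n) 0); last by ev_simp; ring.
move=> Je.
have Jr : J (r * (s b b * s (th0 n) j)).
  by rewrite -(addrK (e (th0 n) 0) (r * _)) [r * _ + _]addrC; apply: JB.
have ui := diag_unit Hs hi; have ub := diag_unit Hs hb.
(* x and y invert the two diagonal entries modulo I. *)
set x := minv s i i in ui; set y := minv s b b in ub.
have -> : s (th0 n) j = x * y * (r * (s b b * s (th0 n) j))
   - s (th0 n) j * (s b b * y) * (r * x - 1) - s (th0 n) j * (s b b * y - 1) by ring.
by apply: JB; [apply: JB|]; apply: JM => //; apply: IJ.
Qed.

Lemma entry_diag0 s j : H s -> j != th0 n -> J (s (th0 n) (th0 n) - s j j).
Proof.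
move=> Hs hj; have hj' := rev_hb hj.
have [i [hi nij nij' _ _]] := third_index j j hn.
have nji : rev_ord j != i by ord_neq.
have [s' [Hs' _]] := extra_conj_entry Hs hi hj' nji.
rewrite rev_ordK => e.
have -> : s (th0 n) (th0 n) - s j j = s' (th0 n) j - s (th0 n) j + s (th0 n) (rev_ord j)
    + s j (th0 n) - s j (rev_ord j) by rewrite e; ring.
apply: JB; last by apply/IJ/entry_offdiag => //; exact: rev_neq.
apply: JD; last by apply/IJ/entry_offdiag => //; rewrite eq_sym.
by apply: JD; [apply: JB|]; apply: entry_zero.
Qed.

End Entries.

(** * Sandwich classification *)

Section Congruence.
Context {R : comNzRingType} {n : nat}.
Variables (I J : set R).
Hypothesis IJ : admissible I J.
Implicit Types (i j k : Theta n) (u v w : 'cV[R]_(n.*2.+1)) (s t A B : 'M[R]_(n.*2.+1)).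

Let II : is_ideal I. Proof. by case: IJ => -[]. Qed.
Let JJ : is_ideal J. Proof. by case: IJ => -[]. Qed.
Let I0 : I 0. Proof. by case: II. Qed.
Let ID a b : I a -> I b -> I (a + b). Proof. by case: II => _ + _; apply. Qed.
Let JD a b : J a -> J b -> J (a + b). Proof. by case: JJ => _ + _; apply. Qed.
Let IM a b : I b -> I (a * b). Proof. by case: II => _ _; apply. Qed.
Let JM a b : J b -> J (a * b). Proof. by case: JJ => _ _; apply. Qed.
Let IleJ a : I a -> J a. Proof. by case: IJ => _ _ _; apply. Qed.

Lemma lattice_ideal_bpair v w : lattice I J w -> I (bpair v w).
Proof.
move=> [wI wJ]; have [_ J2 _ _] := IJ.
apply: big_ind => // j _; have [->|hj] := eqVneq j (th0 n).
  rewrite (_ : _ * _ = v (rev_ord (th0 n)) 0 * (2%:R * w (th0 n) 0)) /=; last by ring.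
  exact/IM/J2.
by rewrite mulrA; apply/IM/wI.
Qed.

Lemma EO_lattice t w : EO R n t -> lattice I J w -> lattice I J (t *m w).
Proof.
move=> Et; move: t Et w; apply: EO_ind => [w|s t _ _ sP tP w lw|i v hi vi w lw].
- by rewrite mul1mx.
- by rewrite -mulmxA; apply/sP/tP.
have Ib := lattice_ideal_bpair v lw; have [wI wJ] := lw.
have wi : I (w (rev_ord i) 0) by apply/wI/rev_hb.
have row k : exists2 c, I c & (esd (ev i) v *m w) k 0 = w k 0 + c.
  exists ((k == i)%:R * bpair v w + (- v k 0 - quadQ v * (k == i)%:R) * w (rev_ord i) 0).
    by apply: ID; apply: IM.
  by rewrite esd_row //; ring.
split => [k hk|]; first by have [c Ic ->] := row k; apply: ID => //; apply: wI.
by have [c Ic ->] := row (th0 n); apply: JD => //; apply: IleJ.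
Qed.

Lemma latticeB v w : lattice I J v -> lattice I J w -> lattice I J (v - w).
Proof.
move=> [vI vJ] [wI wJ]; split => [k hk|]; rewrite !mxE -mulN1r.
  by apply: ID; [exact: vI | apply/IM/wI].
by apply: JD => //; apply: JM.
Qed.

(** [s,t] - 1 = ((s - c) t - t (s - c)) s^-1 t^-1, and t preserves I^2n + J. *)
Lemma scalar_mod_comm s t c : Ogrp R n s -> EO R n t ->
  (forall w, lattice I J ((s - c%:M) *m w)) -> Orel I J (mcomm s t).
Proof.
move=> sO Et sc; have sG : GL s by case: sO.
have tG := EO_GL Et; have tO := EO_O Et; have [_ O1 OM OV] := @Ogrp_subgroup R n.
have mO : Ogrp R n (mcomm s t) by apply: (OM); [apply: (OM); [exact: OM|]|]; exact: OV.
have lat j : lattice I J ((mcomm s t - 1%:M) *m ev j).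
  set x := minv s *m (minv t *m ev j).
  have -> : (mcomm s t - 1%:M) *m ev j
      = (s - c%:M) *m (t *m x) - t *m ((s - c%:M) *m x).
    have tsx : t *m (s *m x) = ev j.
      by rewrite /x (mulmxA s) mulmx_minv // mul1mx mulmxA mulmx_minv // mul1mx.
    have stx : mcomm s t *m ev j = s *m (t *m x) by rewrite /x /mcomm !mulmxA.
    rewrite !mulmxBl mulmxBr stx tsx mul1mx !mul_scalar_mx -scalemxAr.
    by apply/colP => i; rewrite !mxE; ring.
  by apply: latticeB => //; apply: EO_lattice.
have ent i j : ((mcomm s t - 1%:M) *m ev j) i 0 = mcomm s t i j - (i == j)%:R.
  by rewrite mulmx_ev !mxE.
by split => // [i j hi|j]; rewrite -ent; have [] := lat j; auto.
Qed.

Lemma lattice_rows A : (forall i j, i != th0 n -> I (A i j)) -> (forall j, J (A (th0 n) j)) ->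
  forall w, lattice I J (A *m w).
Proof.
move=> AI AJ w; have J0 : J 0 by case: JJ.
split => [i hi|]; rewrite mxE; apply: big_ind => // j _; rewrite mulrC.
  exact/IM/AI.
exact: JM.
Qed.

End Congruence.

Section Main.
Context {R : comNzRingType} {n : nat} (hn : (3 <= n)%N).
Variable H : set 'M[R]_(n.*2.+1).
Hypothesis HO : is_subgroup (Ogrp R n) H.

Lemma level_sandwich_upper : normalized_by (EO R n) H ->
  H `<=` COrel (short_level H) (extra_level H).
Proof.
have HGL : H `<=` @GL R n.*2.+1 by case: HO => HsubO _ _ _ s /HsubO[].
move=> /(normalized_byP EO_subgroupGL HGL) HJ s Hs.
have [HsubO _ _ _] := HO; have sO := HsubO s Hs.
split => // _ [t Et <-].
have ad := level_admissible hn HO HJ.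
have [a ha] := hb_index hn.
apply: (@scalar_mod_comm _ _ _ _ ad s t (s a a)) => //.
apply: lattice_rows => // [i j hi|j]; rewrite !mxE.
  have [<-|nij] := eqVneq i j; first by rewrite mulr1n; apply: entry_diag.
  by rewrite mulr0n subr0; apply: entry_offdiag => //; rewrite eq_sym.
have [->|hj] := eqVneq j (th0 n); first by rewrite mulr1n; apply: entry_diag0.
by rewrite mulr0n subr0; apply: entry_zero.
Qed.
End Main.

Theorem corollary23 (n : nat) (hn : (3 <= n)%N) (R : comNzRingType)
    (H : set 'M[R]_(n.*2.+1)) (hH : is_subgroup (Ogrp R n) H) :
  normalized_by (EO R n) H <->
  exists I J : set R,
    [/\ admissible I J, EOrel I J `<=` H & H `<=` COrel I J].
Proof.
have [HsubO _ HM _] := hH.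
have HGL : H `<=` @GL R n.*2.+1 by move=> s /HsubO[].
split => [nH|[I [J [IJ EH HC]]]].
  have HJ := (normalized_byP EO_subgroupGL HGL).1 nH.
  exists (short_level H), (extra_level H); split.
  - exact: level_admissible.
  - exact: EOrel_level.
  - exact: level_sandwich_upper.
apply/(normalized_byP EO_subgroupGL HGL) => g h Eg Hh.
have gG := EO_GL Eg; have hG := HGL h Hh.
rewrite -[_ *m minv g](mulmx_minvK (s := h)) // -/(mcomm g h).
apply: HM => //; apply: EH; rewrite -[mcomm g h]minvK; last by do ?[apply: GLM|apply: GLV].
have [[II JJ] _ _ _] := IJ.
apply: EOrelV => //; have -> : minv (mcomm g h) = mcomm h g.
  by rewrite /mcomm !minvM ?minvK ?mulmxA //; do ?[apply: GLM|apply: GLV].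
by apply: COrel_comm => //; apply: HC.
Qed.
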